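(* Let $\varepsilon_1,\varepsilon_2,\dots$ be independent with $\varepsilon_i\sim N(0,\sigma_1^2)$ and let $M<\infty$ be such that $\int_0^1|X_i(t)|\,dt\le M$ for all $i$. Let $p=p_n$ depend on $n$ and suppose that the following hold. (A-1) There exists $S<\infty$ such that $S_p\le S$ for all $p$. (A-2) There exists $m>0$ such that $p^m\omega_p$ is bounded, that is, $\omega_p\le H/p^m$ for some $H<\infty$. (A-3) For a given $t\in[0,1]$ there exists $b_t$ such that $p^{-b_t}\alpha_{n,p}(t)$ is bounded for all $n$ and $p$. (A-4) There exists $c$ such that $p^{-c}\sup_t\alpha_{n,p}(t)$ is bounded for all $n$ and $p$. (A-6) $\delta^{V_{n,p_n}}_{2S}+\theta^{V_{n,p_n}}_{S,2S}$ is bounded away from one (from below one) for large enough $n$, where $n\to\infty$, $p_n\to\infty$ and $p_n/n\to0$. Let $\widehat\beta_n$ be the FLiRTI estimate based on $n$ observations, computed (with the Dantzig selector or the lasso) with $p=p_n$ and $\lambda=\sigma_1\sqrt{2(1+\phi)\log p}+M\omega_p\sqrt n$, where $\phi\ge0$ is fixed. Suppose also that $\boldsymbol\gamma_p=A\boldsymbol\eta_p$ has at most $S_p$ non-zero components, $\delta^{V_{n,p}}_{2S_p}+\theta^{V_{n,p}}_{S_p,2S_p}<1$, and, if the lasso is used, $\mathbf{u}=(D_\lambda\tilde V^T\tilde VD_\lambda)^{-1}\mathbf{1}\ge\mathbf{0}$ and $\|\tilde V^T\tilde VD_\lambda\mathbf{u}\|_\infty\le1$ (with $V=V_{n,p}$,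 $p=p_n$). Then, provided $b_t$ and $c$ are less than $m$, if $p_n$ grows at the rate of $n^{1/(2m)}$, $$|\widehat\beta_n(t)-\beta(t)|=O\left(\frac{\sqrt{\log n}}{n^{1/2-b_t/(2m)}}\right)\qquad\text{and}\qquad\sup_t|\widehat\beta_n(t)-\beta(t)|=O\left(\frac{\sqrt{\log n}}{n^{1/2-c/(2m)}}\right),$$ where each $O(\cdot)$ statement means that there is a constant $K<\infty$ such that the left side is at most $K$ times the stated rate with probability converging to one as $n\to\infty$.
   Context: Model: for each $n$, $Y_i=\int_0^1X_i(t)\beta(t)\,dt+\varepsilon_i$, $i=1,\dots,n$ (the intercept is taken to be $0$), where $X_i:[0,1]\to\mathbb{R}$ are functional predictors, $\beta:[0,1]\to\mathbb{R}$ is the fixed coefficient function and $\varepsilon_i$ are random errors. Distributional statements are conditional on the $X_i$ (which may be treated as fixed). For each $p$, $\mathbf{B}_p(t)=(b_1(t),\dots,b_p(t))^T$ is a given $p$-dimensional basis on $[0,1]$, $\boldsymbol{\eta}_p\in\mathbb{R}^p$, $e_p(t)=\beta(t)-\mathbf{B}_p(t)^T\boldsymbol{\eta}_p$, $\omega_p=\sup_{0\le t\le1}|e_p(t)|$, $A$ (depending on $p$) is an invertible $p\times p$ matrix, $\boldsymbol{\gamma}_p=A\boldsymbol{\eta}_p$, and $S_p$ bounds the number of non-zero components of $\boldsymbol\gamma_p$. All integrals are assumed to exist; $t$ ranges over $[0,1]$ in suprema. ''$p_n$ grows at the rate of $r_n$'' means that $p_n/r_n$ is bounded and bounded away from zero.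 Put $\mathbf{X}_i=\int_0^1X_i(t)\mathbf{B}_p(t)\,dt\in\mathbb{R}^p$, let $X$ be the $n\times p$ matrix with rows $\mathbf{X}_i^T$, let $V=V_{n,p}=XA^{-1}$, and let $\varepsilon_i^*=\varepsilon_i+\int_0^1X_i(t)e_p(t)\,dt$, so that $\mathbf{Y}=V\boldsymbol{\gamma}_p+\boldsymbol{\varepsilon}^*$. The columns of $V$ are assumed non-zero; $\tilde V$ is $V$ with each column divided by its Euclidean norm, and $\tilde V_j$ is its $j$th column. FLiRTI estimate with tuning parameter $\lambda$: let $\widehat{\tilde{\boldsymbol\gamma}}$ be either a lasso solution, minimizing $\frac12\|\mathbf{Y}-\tilde V\mathbf{g}\|_2^2+\lambda\|\mathbf{g}\|_1$ over $\mathbf{g}\in\mathbb{R}^p$, or a Dantzig selector solution, minimizing $\|\mathbf{g}\|_1$ subject to $|\tilde V_j^T(\mathbf{Y}-\tilde V\mathbf{g})|\le\lambda$ for $j=1,\dots,p$. Then $\widehat{\boldsymbol\gamma}$ is obtained by dividing the $j$th component of $\widehat{\tilde{\boldsymbol\gamma}}$ by the Euclidean norm of the $j$th column of $V$, and $\widehat\beta(t)=\mathbf{B}_p(t)^TA^{-1}\widehat{\boldsymbol\gamma}$. $D_\lambda$ is the diagonal matrix with $j$th diagonal entry $1,-1$ or $0$ according to whether the $j$th component of the lasso solution with tuning parameter $\lambda$ is positive, negative or zero; $\mathbf{1}$ is a vector of ones; vector inequalities are componentwise; the inverse of $D_\lambda\tilde V^T\tilde VD_\lambda$ is understood on the coordinates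 where the diagonal of $D_\lambda$ is non-zero. For an $n\times p$ matrix $Z$ and $T\subset\{1,\dots,p\}$, $Z_T$ is the $n\times|T|$ matrix obtained by standardizing the columns of $Z$ to Euclidean norm one and extracting those with indices in $T$. $\delta^Z_S$ is the smallest quantity such that $(1-\delta_S^Z)\|\mathbf{c}\|_2^2\le\|Z_T\mathbf{c}\|_2^2\le(1+\delta_S^Z)\|\mathbf{c}\|_2^2$ for all $T$ with $|T|\le S$ and all $\mathbf{c}\in\mathbb{R}^{|T|}$. For $S+S'\le p$, $\theta^Z_{S,S'}$ is the smallest quantity such that $|(Z_T\mathbf{c})^TZ_{T'}\mathbf{c}'|\le\theta^Z_{S,S'}\|\mathbf{c}\|_2\|\mathbf{c}'\|_2$ for all disjoint $T,T'$ with $|T|\le S$, $|T'|\le S'$ and all vectors $\mathbf{c},\mathbf{c}'$ of corresponding lengths. Finally, $$\alpha_{n,p}(t)=\sqrt{\sum_{j=1}^p\frac{(\mathbf{B}_p(t)^TA_j^{-1})^2}{\frac1n\sum_{i=1}^n\left(\int_0^1X_i(s)\mathbf{B}_p(s)^TA_j^{-1}\,ds\right)^2}},$$ where $A_j^{-1}$ is the $j$th column of $A^{-1}$.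
   Formalization: The exponent b_t in (A-3) is additionally assumed to be non-negative: for b_t < 0 the stated pointwise rate can fail, since the approximation error e_p(t) may be of order n^{-1/2}; a negative b_t can be replaced by 0. *)

(* Defs.v *)
(* MathComp / MathComp-Analysis world. *)
From HB Require Import structures.
From mathcomp Require Import all_boot all_order all_algebra.
From mathcomp Require Import all_classical all_reals all_analysis.
Set Implicit Arguments.
Unset Strict Implicit.
Unset Printing Implicit Defensive.
Import Order.TTheory GRing.Theory Num.Theory.
Import numFieldNormedType.Exports.
Local Open Scope classical_set_scope.
Local Open Scope ring_scope.

Definition int01 (R : realType) (f : R -> R) : R :=
  \int[lebesgue_measure]_(t in `[0, 1]) f t.

Definition integrable01 (R : realType) (f : R -> R) : Prop :=
  lebesgue_measure.-integrable `[(0 : R), 1] (EFin \o f).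

(* Extended-real valued: an unbounded f has supremum +oo. *)
Definition sup01 (R : realType) (f : R -> R) : \bar R :=
  ereal_sup [set (f t)%:E | t in `[0, 1]].

Definition l1norm (R : realType) (k : nat) (v : 'cV[R]_k) : R :=
  \sum_(j < k) `|v j 0|.

Definition l2norm (R : realType) (k : nat) (v : 'cV[R]_k) : R :=
  Num.sqrt (\sum_(j < k) v j 0 ^+ 2).

Definition nb_nonzero (R : realType) (k : nat) (v : 'cV[R]_k) : nat :=
  #|[set j : 'I_k | v j 0 != 0]%SET|.

Definition dotv (R : realType) (k : nat) (u v : 'cV[R]_k) : R :=
  \sum_(j < k) u j 0 * v j 0.

(* The p coordinate functions of B are linearly independent on [0, 1]. *)
Definition basis01 (R : realType) (p : nat) (B : R -> 'cV[R]_p) : Prop :=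
  forall c : 'cV[R]_p, (forall t, t \in `[0, 1] -> dotv (B t) c = 0) -> c = 0.

Definition approx_err (R : realType) (beta : R -> R) (p : nat)
    (B : R -> 'cV[R]_p) (eta : 'cV[R]_p) (t : R) : R :=
  beta t - dotv (B t) eta.

Definition omega_sup (R : realType) (beta : R -> R) (p : nat)
    (B : R -> 'cV[R]_p) (eta : 'cV[R]_p) : \bar R :=
  sup01 (fun t => `|approx_err beta B eta t|).

(* Observations are indexed from 0: the first n of them are X 0, ..., X n.-1. *)
Definition score_mx (R : realType) (X : nat -> R -> R) (p : nat)
    (B : R -> 'cV[R]_p) (n : nat) : 'M[R]_(n, p) :=
  \matrix_(i < n, j < p) int01 (fun t => X i t * B t j 0).

Definition design_mx (R : realType) (X : nat -> R -> R) (p : nat)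
    (B : R -> 'cV[R]_p) (A : 'M[R]_p) (n : nat) : 'M[R]_(n, p) :=
  score_mx X B n *m invmx A.

Definition std_cols (R : realType) (n p : nat) (Z : 'M[R]_(n, p)) :
    'M[R]_(n, p) :=
  \matrix_(i < n, j < p) (Z i j / l2norm (col j Z)).

(* Z_T: standardized columns of Z with index in T, in increasing order. *)
Definition std_sub (R : realType) (n p : nat) (Z : 'M[R]_(n, p))
    (T : {set 'I_p}) : 'M[R]_(n, #|T|) :=
  colsub (fun k : 'I_#|T| => enum_val k) (std_cols Z).

(* The sets whose infimum is taken are closed and non-empty, so the infimum is
   the smallest element.  The constraint 0 <= d is automatic as soon as S and p
   are positive, and gives the value 0 in the degenerate cases. *)
Definition delta_rip (R : realType) (n p : nat) (S : nat)
    (Z : 'M[R]_(n, p)) : R :=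
  inf [set d : R | 0 <= d /\
    forall (T : {set 'I_p}) (c : 'cV[R]_#|T|), (#|T| <= S)%N ->
      (1 - d) * l2norm c ^+ 2 <= l2norm (std_sub Z T *m c) ^+ 2
        <= (1 + d) * l2norm c ^+ 2].

Definition theta_rip (R : realType) (n p : nat) (S S' : nat)
    (Z : 'M[R]_(n, p)) : R :=
  inf [set d : R | 0 <= d /\
    forall (T T' : {set 'I_p}) (c : 'cV[R]_#|T|) (c' : 'cV[R]_#|T'|),
      (#|T| <= S)%N -> (#|T'| <= S')%N -> [disjoint T & T']%bool ->
      `|dotv (std_sub Z T *m c) (std_sub Z T' *m c')|
        <= d * l2norm c * l2norm c'].

Definition is_lasso (R : realType) (n p : nat) (Z : 'M[R]_(n, p))
    (Y : 'cV[R]_n) (lambda : R) (g : 'cV[R]_p) : Prop :=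
  forall h : 'cV[R]_p,
    2^-1 * l2norm (Y - Z *m g) ^+ 2 + lambda * l1norm g
      <= 2^-1 * l2norm (Y - Z *m h) ^+ 2 + lambda * l1norm h.

Definition dantzig_feasible (R : realType) (n p : nat) (Z : 'M[R]_(n, p))
    (Y : 'cV[R]_n) (lambda : R) (g : 'cV[R]_p) : Prop :=
  forall j : 'I_p, `|dotv (col j Z) (Y - Z *m g)| <= lambda.

Definition is_dantzig (R : realType) (n p : nat) (Z : 'M[R]_(n, p))
    (Y : 'cV[R]_n) (lambda : R) (g : 'cV[R]_p) : Prop :=
  dantzig_feasible Z Y lambda g /\
  forall h : 'cV[R]_p, dantzig_feasible Z Y lambda h -> l1norm g <= l1norm h.

Definition sign_mx (R : realType) (p : nat) (g : 'cV[R]_p) : 'M[R]_p :=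
  diag_mx (\row_(j < p) Num.sg (g j 0)).

(* The inverse of D Z^T Z D is taken on the support T of the diagonal of D, so
   u is indexed by T; off T the columns of D vanish, so that D u only involves
   the columns of D in T. *)
Definition lasso_dual_condition (R : realType) (n p : nat)
    (Z : 'M[R]_(n, p)) (g : 'cV[R]_p) : Prop :=
  let D := sign_mx g in
  let T : {set 'I_p} := [set j | g j 0 != 0]%SET in
  let ix := fun k : 'I_#|T| => enum_val k in
  let G : 'M[R]_#|T| := mxsub ix ix (D *m Z^T *m Z *m D) in
  let u : 'cV[R]_#|T| := invmx G *m const_mx 1 in
  [/\ G \in unitmx,
      forall k, 0 <= u k 0
    & forall j, `|(Z^T *m Z *m colsub ix D *m u) j 0| <= 1].

Definition gamma_hat (R : realType) (n p : nat) (V : 'M[R]_(n, p))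
    (g : 'cV[R]_p) : 'cV[R]_p :=
  \col_(j < p) (g j 0 / l2norm (col j V)).

Definition beta_hat (R : realType) (p : nat) (B : R -> 'cV[R]_p)
    (A : 'M[R]_p) (gam : 'cV[R]_p) (t : R) : R :=
  dotv (B t) (invmx A *m gam).

(* A zero denominator, i.e. a zero column of the design matrix, contributes 0
   to the sum. *)
Definition alpha_np (R : realType) (X : nat -> R -> R) (p : nat)
    (B : R -> 'cV[R]_p) (A : 'M[R]_p) (n : nat) (t : R) : R :=
  Num.sqrt (\sum_(j < p)
    dotv (B t) (col j (invmx A)) ^+ 2 /
    (n%:R^-1 * \sum_(i < n)
       int01 (fun s => X i s * dotv (B s) (col j (invmx A))) ^+ 2)).

Definition response (R : realType) (Omega : Type) (X : nat -> R -> R)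
    (beta : R -> R) (eps : nat -> Omega -> R) (n : nat) (w : Omega) :
    'cV[R]_n :=
  \col_(i < n) (int01 (fun t => X i t * beta t) + eps i w).

Definition tuning (R : realType) (sigma1 phi M omega : R) (n p : nat) : R :=
  sigma1 * Num.sqrt (2 * (1 + phi) * ln p%:R) + M * omega * Num.sqrt n%:R.

Definition mutually_independent (R : realType) (d : measure_display)
    (Omega : measurableType d) (P : probability Omega R)
    (eps : nat -> {RV P >-> R}) : Prop :=
  forall (s : seq nat) (E : nat -> set R),
    uniq s -> (forall i, measurable (E i)) ->
    P (\bigcap_(i in [set` s]) (eps i @^-1` E i)) =
    (\prod_(i <- s) P (eps i @^-1` E i))%E.

Definition is_normal (R : realType) (d : measure_display)
    (Omega : measurableType d) (P : probability Omega R)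
    (Z : {RV P >-> R}) (mean sd : R) : Prop :=
  forall E : set R, measurable E -> distribution P Z E = normal_prob mean sd E.

(* For measurable events Q n this says P (Q n) --> 1; in general the inner
   probability of Q n tends to 1.  Measurability is not presupposed because
   minimizers of the lasso and Dantzig problems need not be unique, so that a
   choice of minimizer need not depend measurably on the outcome. *)
Definition with_prob_to_one (R : realType) (d : measure_display)
    (Omega : measurableType d) (P : probability Omega R)
    (Q : nat -> set Omega) : Prop :=
  exists E : nat -> set Omega,
    [/\ forall n, measurable (E n), forall n, E n `<=` Q n
      & P (E n) @[n --> \oo] --> 1%E].

Definition grows_at_rate (R : realType) (p : nat -> nat) (r : nat -> R) :
    Prop :=
  exists k K : R, 0 < k /\
    forall n, (0 < n)%N -> k <= (p n)%:R / r n <= K.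

(* Main.v *)
Require Import Defs.
From HB Require Import structures.
From mathcomp Require Import all_boot all_order all_algebra.
From mathcomp Require Import all_classical all_reals all_analysis.
From mathcomp Require Import measurable_realfun ring lra.
Set Implicit Arguments.
Unset Strict Implicit.
Unset Printing Implicit Defensive.
Import Order.TTheory GRing.Theory Num.Theory.
Import numFieldNormedType.Exports.
Local Open Scope classical_set_scope.
Local Open Scope ring_scope.

(** The estimate is analysed on the scale of the standardized design [Z], with
    unit columns.  Three facts are combined.

    Noise.  For each column [z] of [Z] the variable [sum_i z_i eps_i] is centred
    Gaussian with the variance of a single error ([gaussian_sum_law]), so Mills'
    bound on the Gaussian tail gives
    [P (|sum_i z_i eps_i| > sigma * x) <= C * exp (- x^2 / 2) / x].  At
    [x = sqrt (2 (1 + phi) ln p)] a union bound over the [p] columns leaves at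
    most [C / sqrt (ln p)], which tends to zero even when [phi = 0]; a Chernoff
    bound would not be enough there.  On this event, and because the second part
    of the tuning parameter dominates the contribution of the approximation error
    of [beta], the true coefficient vector satisfies the constraints of the
    Dantzig selector ([true_coef_feasible]).

    Sparse recovery.  The difference [h] between a Dantzig selector solution and a
    feasible [S]-sparse vector has at least half of its l1 mass on [S]
    coordinates, and [Z^T Z h] has entries at most [2 * lambda].  Cutting the
    other coordinates into blocks of [S] entries of decreasing size turns the
    restricted isometry and orthogonality constants into the l2 bound
    [4 * sqrt S * lambda / (1 - delta - theta)] on [h]
    ([cone_l2_bound], [dantzig_l2_error]).  A lasso solution satisfying the dual
    condition is a Dantzig selector solution, by linear programming duality
    ([lasso_is_dantzig]).

    Rates.  By the Cauchy-Schwarz inequality the estimation error of [beta] at [t]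
    is at most [alpha_np t / sqrt n] times the l2 norm of [h], plus the
    approximation error ([beta_hat_error]).  With [p] of order [n `^ (2 * m)^-1]
    the approximation error is at most of order [n `^ (- 2^-1)] and [lambda] at
    most of order [sqrt (ln n)], which gives both rates ([rate_bound]).  For the supremum over
    [t] this also needs [0 <= c], which holds because the supremum of [alpha_np]
    is bounded below ([sup_alpha_lower]). *)

(** The standard normal law on the real line. *)
Local Notation std R := (normal_prob (0 : R) 1).

(** * Linear combinations of independent Gaussian variables *)

Lemma preimage_affine_oc (R : realType) (a c l u : R) : 0 < a ->
  (fun x => a * x + c) @^-1` `]l, u] = `](l - c) / a, (u - c) / a]%classic.
Proof.
move=> a0; apply/seteqP; split => x /=; rewrite !in_itv/= ltr_pdivrMr// ler_pdivlMr//;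
 rewrite ltrBlDr lerBrDr [x * a]mulrC //.
Qed.

Lemma preimage_affine_co (R : realType) (a c l u : R) : a < 0 ->
  (fun x => a * x + c) @^-1` `]l, u] = `[(u - c) / a, (l - c) / a[%classic.
Proof.
move=> a0; apply/seteqP; split => x /=; rewrite !in_itv/= ltr_ndivlMr// ler_ndivrMr//;
 rewrite ltrBlDr lerBrDr [x * a]mulrC andbC //.
Qed.

Lemma measurable_affine (R : realType) (a c : R) :
  measurable_fun [set: measurableTypeR R]
    ((fun x => a * x + c) : measurableTypeR R -> measurableTypeR R).
Proof. by apply: measurable_funD => //; apply: measurable_funM. Qed.

(** Lebesgue measure is multiplied by [`|a|^-1] under pullback along the affine
    map [x |-> a * x + c]. *)
Lemma lebesgue_measure_affine (R : realType) (a c : R) (E : set (measurableTypeR R)) :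
  a != 0 -> measurable E ->
  lebesgue_measure E =
    ((`|a|%R)%:E * pushforward lebesgue_measure
       ((fun x => a * x + c)%R : measurableTypeR R -> measurableTypeR R) E)%E.
Proof.
move=> a0 mE.
have mf := @measurable_affine R a c.
pose mu' : {measure set (measurableTypeR R) -> \bar R} :=
  mscale (NngNum (normr_ge0 a)) (pushforward lebesgue_measure
       ((fun x => a * x + c) : measurableTypeR R -> measurableTypeR R)).
rewrite -[RHS]/(mu' mf E); apply: lebesgue_measure_unique => // _ [[l u]] _ <-.
rewrite /mu' /= /mscale /= /pushforward.
case: (ltgtP a 0) a0 => // a0 _.
  rewrite preimage_affine_co // !lebesgue_measure_itv/= !lte_fin.
  rewrite ltr_ndivlMr// divfK ?lt_eqF// ltrD2r.
  case: ifP => lu; last by rewrite mule0.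
  rewrite -!EFinD -EFinM ltr0_norm//; congr EFin; field; exact/ltr0_neq0.
rewrite preimage_affine_oc // !lebesgue_measure_itv/= !lte_fin.
rewrite ltr_pdivlMr// divfK ?gt_eqF// ltrD2r.
case: ifP => lu; last by rewrite mule0.
rewrite -!EFinD -EFinM gtr0_norm//; congr EFin; field; exact/lt0r_neq0.
Qed.
(** Integration against a Gaussian law is integration against its density. *)
Lemma integral_normal_prob (R : realType) (m s : R) (f : R -> \bar R) :
  (normal_prob m s).-integrable [set: R] f ->
  (\int[normal_prob m s]_x f x =
   \int[lebesgue_measure]_x (f x * (normal_pdf m s x)%:E))%E.
Proof.
move=> intf; have mf := measurable_int _ intf.
pose nu : {finite_measure set (measurableTypeR R) -> \bar R} := normal_prob m s.
have dom : nu `<< lebesgue_measure by exact: normal_prob_dominates.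
rewrite -(@Radon_Nikodym_change_of_variables _ _ _ nu lebesgue_measure dom)//=.
have intRN : lebesgue_measure.-integrable [set: R]
    (Radon_Nikodym (charge_of_finite_measure nu) lebesgue_measure).
  exact: Radon_Nikodym_integrable.
apply: ae_eq_integral => //.
- apply: emeasurable_funM => //; exact: measurable_int intRN.
- apply: emeasurable_funM => //=; apply/measurable_EFinP.
  exact: measurable_normal_pdf.
- apply: ae_eqe_mul2l => /=; apply: integral_ae_eq => //=.
  + by apply/measurable_EFinP; exact: measurable_normal_pdf.
  + move=> E _ mE; by rewrite -Radon_Nikodym_integral//; exact: dom.
Qed.

(** [x |-> a * x + c] maps the standard normal law to the one with mean [c]
    and standard deviation [a] (of either sign, since only [a ^+ 2] matters). *)
Lemma normal_prob_affine (R : realType) (a c : R) (E : set (measurableTypeR R)) :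
  a != 0 -> measurable E ->
  normal_prob c a E = normal_prob 0 1 ((fun x => a * x + c) @^-1` E).
Proof.
move=> a0 mE; rewrite /normal_prob.
have mf := @measurable_affine R a c.
pose mu' := mscale (NngNum (normr_ge0 a)) (pushforward lebesgue_measure
       ((fun x => a * x + c) : measurableTypeR R -> measurableTypeR R)).
have mpdf : measurable_fun E (EFin \o normal_pdf c a).
  by apply/measurable_EFinP/measurable_funTS; exact: measurable_normal_pdf.
rewrite (@eq_measure_integral _ _ _ _ (mu' mf)); last first.
  by move=> A mA _; exact: lebesgue_measure_affine.
rewrite ge0_integral_mscale//; last by move=> x _; rewrite lee_fin normal_pdf_ge0.
rewrite ge0_integral_pushforward//; last first.
  by move=> x _; rewrite lee_fin normal_pdf_ge0.
have mE' : measurable ((fun x : measurableTypeR R => a * x + c) @^-1` E).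
  by rewrite -[X in measurable X]setTI; exact: mf.
rewrite -ge0_integralZl//=; last 2 first.
- apply/measurable_EFinP/measurable_funTS.
  apply: measurableT_comp => //; exact: measurable_normal_pdf.
- by move=> x _; rewrite lee_fin normal_pdf_ge0.
apply: eq_integral => x _; rewrite -EFinM; congr EFin.
rewrite !normal_pdfE// ?oner_eq0//= mulrA; congr (_ * _).
  rewrite /normal_peak expr1n mul1r -mulrnAr.
  rewrite sqrtrM ?sqr_ge0// sqrtr_sqr invfM mulrA divff ?mul1r// ?normr_eq0//.
rewrite /normal_fun; congr expR.
by rewrite expr1n; field.
Qed.

(** For [a ^+ 2 + b ^+ 2 = 1], the joint density of [(x, a * x + b * z)], with
    [x] and [z] independent standard normal, is symmetric. *)
Lemma normal_pdf_exchange (R : realType) (a b x y : R) :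
  b != 0 -> a ^+ 2 + b ^+ 2 = 1 ->
  normal_pdf 0 1 x * normal_pdf (a * x) b y =
  normal_pdf 0 1 y * normal_pdf (a * y) b x.
Proof.
move=> b0 ab; rewrite !normal_pdfE// ?oner_eq0//=.
rewrite mulrACA [RHS]mulrACA; congr (_ * _).
rewrite /normal_fun -!expRD; congr expR.
have expo u v : - (u - 0) ^+ 2 / (1 ^+ 2 *+ 2) + - (v - a * u) ^+ 2 / (b ^+ 2 *+ 2) =
    - (u ^+ 2 + v ^+ 2 - 2 * a * u * v) / (b ^+ 2 *+ 2).
  transitivity (- (u ^+ 2 * (a ^+ 2 + b ^+ 2) + v ^+ 2 - 2 * a * u * v) / (b ^+ 2 *+ 2)).
    by rewrite subr0 expr1n; field; exact: b0.
  by rewrite ab mulr1.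
by rewrite !expo; congr (- _ / _); ring.
Qed.

Lemma measurable_lincomb (R : realType) (a b : R) :
  measurable_fun [set: measurableTypeR R * measurableTypeR R]
    ((fun z => a * z.1 + b * z.2) :
       measurableTypeR R * measurableTypeR R -> measurableTypeR R).
Proof.
by apply: measurable_funD => //; apply: measurable_funM => //.
Qed.

(** Rotation invariance of the standard Gaussian law on the plane, read on one
    coordinate. *)
Lemma std_normal_rotation (R : realType) (a b : R) (E : set (measurableTypeR R)) :
  a ^+ 2 + b ^+ 2 = 1 -> measurable E ->
  (std R \x std R)%E ((fun z => a * z.1 + b * z.2) @^-1` E) = std R E.
Proof.
move=> ab mE.
have mX : measurable ((fun z : measurableTypeR R * measurableTypeR R =>
     a * z.1 + b * z.2) @^-1` E).
  by rewrite -[X in measurable X]setTI; exact: measurable_lincomb.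
(* for [b = 0] the map is a reflection or the identity in the first coordinate *)
have [b0|b0] := eqVneq b 0.
  have a2 : a ^+ 2 = 1 by rewrite -ab b0; ring.
  have a0 : a != 0 by rewrite -sqrf_eq0 a2 oner_eq0.
  have -> : (fun z : R * R => a * z.1 + b * z.2) @^-1` E =
      ((fun x => a * x + 0) @^-1` E) `*` setT.
    by apply/seteqP; split => -[x y] /=; rewrite b0 mul0r // => -[].
  rewrite product_measure1E//; last first.
    by rewrite -[X in measurable X]setTI; exact: measurable_affine.
  have stdT : normal_prob (0 : R) 1 [set: measurableTypeR R] = 1%E.
    exact: probability_setT.
  transitivity (normal_prob 0 1 ((fun x => a * x + 0)%R @^-1` E) * 1)%E.
    by congr mule; exact: stdT.
  rewrite mule1 -(normal_prob_affine 0 a0 mE).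
  rewrite /normal_prob; apply: eq_integral => x _; congr EFin.
  rewrite !normal_pdfE ?oner_eq0//=.
  by rewrite /normal_peak /normal_fun a2 expr1n.
rewrite /= /product_measure1 /=.
(* given [x], the law of [a * x + b * z] has mean [a * x] and deviation [b] *)
have secE x : normal_prob (a * x) b E = normal_prob 0 1
    (xsection ((fun z : R * R => a * z.1 + b * z.2) @^-1` E) x).
  rewrite (normal_prob_affine (a * x) b0 mE); apply: (f_equal (normal_prob 0 1)).
  by apply/seteqP; split => y /=; rewrite /xsection/= inE/= addrC.
transitivity (\int[std R]_x normal_prob (a * x) b E)%E.
  by apply: eq_integral => x _; rewrite secE.
have mpdf2 (c : R) : measurable_fun [set: measurableTypeR R * measurableTypeR R]
    ((fun z => normal_pdf (c * z.1) b z.2) :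
       measurableTypeR R * measurableTypeR R -> measurableTypeR R).
  rewrite (_ : (fun z => _) = fun z => normal_pdf 0 b (- c * z.1 + 1 * z.2)).
    apply: measurableT_comp; first exact: measurable_normal_pdf.
    exact: measurable_lincomb.
  apply/funext => z; rewrite !normal_pdfE//= /normal_fun.
  by rewrite mul1r subr0 (mulNr c) [- (c * _) + _]addrC.
pose f (z : R * R) : \bar R :=
  (\1_E z.2 * (normal_pdf 0 1 z.1 * normal_pdf (a * z.1) b z.2))%:E.
have f0 z : (0 <= f z)%E.
  by rewrite lee_fin mulr_ge0// mulr_ge0// normal_pdf_ge0.
have mf : measurable_fun [set: measurableTypeR R * measurableTypeR R] f.
  apply/measurable_EFinP; apply: measurable_funM.
    by apply: measurableT_comp => //; exact: measurable_indic.
  apply: measurable_funM; last exact: mpdf2.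
  by apply: measurableT_comp => //; exact: measurable_normal_pdf.
rewrite integral_normal_prob; last first.
  have ms : measurable_fun [set: R] (fun x => normal_prob (a * x) b E).
    rewrite (_ : (fun x => _) = std R \o
        xsection ((fun z : R * R => a * z.1 + b * z.2) @^-1` E)); last first.
      by apply/funext => x; exact: secE.
    exact: measurable_fun_xsection.
  apply: (@le_integrable _ _ _ (normal_prob 0 1) _ measurableT _ (cst 1%E)) => //.
    move=> x _; apply: (le_trans _ (lee_abs _)); rewrite gee0_abs//.
    by rewrite secE; apply: probability_le1; exact: measurable_xsection.
  by apply/finite_measure_integrable_cst.
transitivity (\int[lebesgue_measure]_x \int[lebesgue_measure]_y f (x, y))%E.
  apply: eq_integral => x _; rewrite /f /= /normal_prob integral_mkcond.
  rewrite muleC -ge0_integralZl//; first last.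
  - by rewrite lee_fin normal_pdf_ge0.
  - move=> y _; rewrite patchE; case: ifPn => // _; rewrite lee_fin normal_pdf_ge0//.
  - apply/measurable_restrict => //; apply/measurable_EFinP/measurable_funTS.
    exact: measurable_normal_pdf.
  apply: eq_integral => y _; rewrite patchE indicE; case: ifPn => yE.
    by rewrite mul1r EFinM.
  by rewrite mule0 mul0r.
rewrite fubini_tonelli//= /normal_prob [RHS]integral_mkcond.
apply: eq_integral => y _; rewrite patchE.
under eq_integral => x _ do rewrite /f /= normal_pdf_exchange//.
case: ifPn => yE.
  rewrite indicE yE.
  under eq_integral => x _ do rewrite mul1r EFinM.
  rewrite ge0_integralZl//.
  - by rewrite integral_normal_pdf mule1.
  - by apply/measurable_EFinP; exact: measurable_normal_pdf.
  - by move=> x _; rewrite lee_fin normal_pdf_ge0.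
  - by rewrite lee_fin normal_pdf_ge0.
apply: integral0_eq => x _; by rewrite indicE (negbTE yE) mul0r.
Qed.
Lemma std_normal_lincomb (R : realType) (a b : R) (E : set (measurableTypeR R)) :
  measurable E ->
  (std R \x std R)%E ((fun z => a * z.1 + b * z.2) @^-1` E) =
  std R ((fun z => Num.sqrt (a ^+ 2 + b ^+ 2) * z) @^-1` E).
Proof.
move=> mE; set r := Num.sqrt _.
have r2 : r ^+ 2 = a ^+ 2 + b ^+ 2 by rewrite sqr_sqrtr// addr_ge0// sqr_ge0.
have [r0|r0] := eqVneq r 0.
  have : a ^+ 2 + b ^+ 2 == 0 by rewrite -r2 r0 expr0n.
  rewrite paddr_eq0 ?sqr_ge0// !sqrf_eq0 => /andP[/eqP-> /eqP->].
  have stdT : std R [set: measurableTypeR R] = 1%E by exact: probability_setT.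
  have std0 : std R (set0 : set (measurableTypeR R)) = 0%E by exact: measure0.
  have [E0|E0] := pselect (E 0).
    transitivity (1 * 1 : \bar R)%E; last first.
      rewrite mule1 -stdT; apply: (f_equal (std R)).
      by apply/seteqP; split => x //= _; rewrite r0 mul0r.
    rewrite (_ : _ @^-1` E = setT `*` setT).
      by rewrite product_measure1E//; congr mule; exact: stdT.
    by apply/seteqP; split => x //= _; rewrite !mul0r addr0.
  transitivity (0 : \bar R)%E.
    rewrite (_ : _ @^-1` E = set0); first by rewrite measure0.
    by apply/seteqP; split => x //=; rewrite !mul0r addr0.
  rewrite -std0; apply: (f_equal (std R)).
  by apply/seteqP; split => x //=; rewrite r0 mul0r.
have mE' : measurable ((fun z => r * z + 0) @^-1` E).
  by rewrite -[X in measurable X]setTI; exact: measurable_affine.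
transitivity (std R ((fun z => r * z + 0) @^-1` E)); last first.
  by apply: (f_equal (std R)); apply/seteqP; split => x /=; rewrite addr0.
have abr : (a / r) ^+ 2 + (b / r) ^+ 2 = 1.
  by rewrite !exprMn -mulrDl -r2 -exprMn divff// expr1n.
rewrite -(std_normal_rotation abr mE'); apply: (f_equal (std R \x std R)%E).
apply/seteqP; split => -[x y] /=;
  (have -> : r * (a / r * x + b / r * y) + 0 = a * x + b * y by field).
  by [].
by [].
Qed.

(** The law of [x + v * y] when [x] and [y] are independent centred Gaussian
    variables, in the form of a statement on measures on the plane. *)
Lemma normal_convolution (R : realType) (tau s v : R)
    (mu : {measure set (measurableTypeR R * measurableTypeR R) -> \bar R})
    (E : set (measurableTypeR R)) :
  (forall A B : set (measurableTypeR R), measurable A -> measurable B ->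
    mu (A `*` B) = (std R ((fun z => tau * z)%R @^-1` A) *
                    std R ((fun z => s * z)%R @^-1` B))%E) ->
  measurable E ->
  mu ((fun z => z.1 + v * z.2) @^-1` E) =
  std R ((fun z => Num.sqrt (tau ^+ 2 + (v * s) ^+ 2) * z) @^-1` E).
Proof.
move=> muE mE; rewrite -std_normal_lincomb//.
have mscal c : measurable_fun [set: measurableTypeR R]
    ((fun z => c * z) : measurableTypeR R -> measurableTypeR R).
  exact: measurable_funM.
pose X c : {mfun measurableTypeR R >-> measurableTypeR R} :=
  HB.pack (fun z : measurableTypeR R => c * z)
    (isMeasurableFun.Build _ _ _ _ _ (mscal c)).
have mpair : measurable_fun [set: measurableTypeR R * measurableTypeR R]
    ((fun z => (tau * z.1, s * z.2)) : measurableTypeR R * measurableTypeR R ->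
       measurableTypeR R * measurableTypeR R).
  by apply: measurable_fun_pair => /=; apply: measurable_funM.
have mX : measurable ((fun z : measurableTypeR R * measurableTypeR R => z.1 + v * z.2) @^-1` E).
  have ml : measurable_fun [set: measurableTypeR R * measurableTypeR R]
      ((fun z => z.1 + v * z.2) : _ -> measurableTypeR R).
    by apply: measurable_funD => //; apply: measurable_funM.
  by rewrite -[X in measurable X]setTI; exact: ml.
pose m1 := distribution (normal_prob 0 1) (X tau).
pose m2 := distribution (normal_prob 0 1) (X s).
pose mu2 : {measure set (measurableTypeR R * measurableTypeR R) -> \bar R} :=
  pushforward (std R \x std R)%E
    ((fun z => (tau * z.1, s * z.2)) : measurableTypeR R * measurableTypeR R ->
       measurableTypeR R * measurableTypeR R).
have e1 : (m1 \x m2)%E ((fun z => z.1 + v * z.2) @^-1` E) =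
    mu ((fun z => z.1 + v * z.2) @^-1` E).
  by apply: product_measure_unique mX => A B mA mB; exact: muE.
have e2 : (m1 \x m2)%E ((fun z => z.1 + v * z.2) @^-1` E) =
    mu2 mpair ((fun z => z.1 + v * z.2) @^-1` E).
  apply: product_measure_unique mX => A B mA mB.
  transitivity ((std R \x std R)%E ((X tau @^-1` A) `*` (X s @^-1` B))).
    exact: erefl.
  apply: product_measure1E.
    by rewrite -[X in measurable X]setTI; exact: (mscal tau).
  by rewrite -[X in measurable X]setTI; exact: (mscal s).
rewrite -e1 e2; apply: (f_equal (std R \x std R)%E).
by apply/seteqP; split => z /=; rewrite mulrA.
Qed.

Lemma normal_probE (R : realType) (s : R) (E : set (measurableTypeR R)) :
  s != 0 -> measurable E ->
  normal_prob 0 s E = std R ((fun z => s * z) @^-1` E).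
Proof.
move=> s0 mE; rewrite (normal_prob_affine 0 s0 mE).
by apply: (f_equal (std R)); apply/seteqP; split => x /=; rewrite addr0.
Qed.

(** A partial sum of weighted independent centred Gaussian variables is Gaussian,
    and independent of the later variables.  The second part is what makes the
    induction on the number of terms go through. *)
Lemma gaussian_sum_law (R : realType) (d : measure_display)
    (Omega : measurableType d) (P : probability Omega R)
    (eps : nat -> {RV P >-> R}) (s : R) (v : nat -> R) :
  s != 0 -> mutually_independent eps -> (forall i, is_normal (eps i) 0 s) ->
  forall (k : nat) (E : set (measurableTypeR R)) (l : seq nat) (F : nat -> set R),
  measurable E -> uniq l -> all (leq k) l -> (forall i, measurable (F i)) ->
  P ((fun w => \sum_(i < k) v i * eps i w) @^-1` E `&`
     \bigcap_(i in [set` l]) (eps i @^-1` F i)) =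
  (std R ((fun z => Num.sqrt (\sum_(i < k) (v i * s) ^+ 2)%R * z)%R @^-1` E) *
   \prod_(i <- l) P (eps i @^-1` F i))%E.
Proof.
move=> s0 indep Neps.
have stdT : std R [set: measurableTypeR R] = 1%E by exact: probability_setT.
have std0 : std R (set0 : set (measurableTypeR R)) = 0%E by exact: measure0.
have meps i : measurable_fun [set: Omega] (eps i : _ -> measurableTypeR R).
  move=> mT Y mY.
  have mf : measurable_fun [set: Omega] (eps i) by [].
  exact: mf.
elim=> [|k IH] E l F mE ul kl mF.
  have [E0|E0] := pselect (E 0).
    rewrite (_ : _ @^-1` E = setT); last first.
      by apply/seteqP; split => // w _ /=; rewrite big_ord0.
    rewrite setTI indep// (_ : _ @^-1` E = setT) ?stdT ?mul1e//.
    by apply/seteqP; split => // w _ /=; rewrite big_ord0 sqrtr0 mul0r.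
  rewrite (_ : _ @^-1` E = set0); last first.
    by apply/seteqP; split => // w /=; rewrite big_ord0.
  rewrite set0I measure0 (_ : _ @^-1` E = set0) ?std0 ?mul0e//.
  by apply/seteqP; split => // w /=; rewrite big_ord0 sqrtr0 mul0r.
set D := \bigcap_(i in _) _.
have mD : measurable D.
  rewrite /D bigcap_seq; apply: bigsetI_measurable => i _.
  by rewrite -[X in measurable X]setTI; exact: measurable_funP.
have PD : P D = (\prod_(i <- l) P (eps i @^-1` F i))%E by exact: indep.
rewrite -PD.
pose Sk w := \sum_(i < k) v i * eps i w.
have mSk : measurable_fun [set: Omega] (Sk : _ -> measurableTypeR R).
  by apply: measurable_sum => i; apply: measurable_funM.
have mp : measurable_fun [set: Omega]
    ((fun w => (Sk w, eps k w)) : _ -> measurableTypeR R * measurableTypeR R).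
  apply: measurable_fun_pair; first exact: mSk.
  exact: meps.
have msum : measurable ((fun w => \sum_(i < k.+1) v i * eps i w) @^-1` E).
  have ms : measurable_fun [set: Omega]
      ((fun w => \sum_(i < k.+1) v i * eps i w) : _ -> measurableTypeR R).
    by apply: measurable_sum => i; apply: measurable_funM.
  by rewrite -[X in measurable X]setTI; exact: ms.
have [PD0|PD0] := eqVneq (P D) 0%E.
  rewrite PD0 mule0; apply/eqP; rewrite eq_le measure_ge0 andbT -PD0.
  apply: le_measure; rewrite ?inE//; exact: measurableI.
have PDfin : P D \is a fin_num by exact: fin_num_measure.
have q0 : 0 <= (fine (P D))^-1 by rewrite invr_ge0 fine_ge0.
(* [mu] is the joint law of the partial sum and the next variable, conditionally
   on the event [D] on the later variables *)
pose mu : {measure set (measurableTypeR R * measurableTypeR R) -> \bar R} :=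
  mscale (NngNum q0) (pushforward (mrestr P mD)
    ((fun w => (Sk w, eps k w)) : _ -> measurableTypeR R * measurableTypeR R)).
have muE X : (P D * mu mp X = P ((fun w => (Sk w, eps k w)) @^-1` X `&` D))%E.
  rewrite /mu /= /mscale /= /pushforward /mrestr muleA.
  rewrite (_ : (P D * _)%E = 1%E) ?mul1e//.
  by rewrite -[P D](fineK PDfin) -EFinM divff// fine_eq0.
transitivity (P D * mu mp ((fun z => z.1 + v k * z.2)%R @^-1` E))%E.
  rewrite muE; apply: (f_equal P); congr (_ `&` _).
  by apply/seteqP; split => w /=; rewrite big_ord_recr.
rewrite muleC; congr (_ * _)%E.
rewrite (@normal_convolution _ (Num.sqrt (\sum_(i < k) (v i * s) ^+ 2)) s)//.
  apply: (f_equal (std R)); rewrite sqr_sqrtr ?big_ord_recr//=.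
  by apply: sumr_ge0 => i _; exact: sqr_ge0.
move=> A B mA mB.
have kNl : k \notin l by apply/negP => /(allP kl); rewrite ltnn.
pose F' i := if i == k then B else F i.
have mF' i : measurable (F' i : set R).
  by rewrite /F'; case: ifP => _; [exact: mB|exact: mF].
have F'l i : i \in l -> F' i = F i.
  by rewrite /F'; case: eqP => // -> kl'; rewrite kl' in kNl.
have kl' : all (leq k) (k :: l).
  by rewrite /= leqnn; apply: sub_all kl => i; exact: ltnW.
have ul' : uniq (k :: l) by rewrite /= kNl.
have := IH A (k :: l) F' mA ul' kl' mF'.
rewrite big_cons {2}/F' eqxx.
have -> : (\prod_(i <- l) P (eps i @^-1` F' i) = P D)%E.
  by rewrite PD; apply: eq_big_seq => i il; rewrite F'l.
have -> : P (eps k @^-1` B) = std R ((fun z => s * z) @^-1` B).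
  by rewrite -(normal_probE s0 mB); exact: Neps.
have -> : (fun w => \sum_(i < k) v i * eps i w) @^-1` A `&`
    \bigcap_(i in [set` k :: l]) (eps i @^-1` F' i) =
    (fun w => (Sk w, eps k w)) @^-1` (A `*` B) `&` D.
  apply/seteqP; split => w /=.
    move=> [Aw Fw]; split; first split => //.
      by have := Fw k; rewrite /= mem_head /F' eqxx => /(_ isT).
    by move=> i /= il; have := Fw i; rewrite /= in_cons il orbT F'l// => /(_ isT).
  move=> [[Aw Bw] Dw]; split => // i /=; rewrite in_cons.
  case: (eqVneq i k) => [->|ik] /= il; first by rewrite /F' eqxx.
  by rewrite F'l//; exact: Dw.
rewrite -muE.
set a := normal_prob 0 1 (_ @^-1` A); set b := normal_prob 0 1 (_ @^-1` B).
move: (mu mp (A `*` B)) => x H.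
have : ((fine (P D))^-1%:E * (P D * x) = (fine (P D))^-1%:E * (P D * (a * b)))%E.
  by rewrite H; congr (_ * _)%E; rewrite muleA muleC.
have invD : ((fine (P D))^-1%:E * P D = 1)%E.
  by rewrite -[X in (_ * X)%E](fineK PDfin) -EFinM mulVf// fine_eq0.
by rewrite !(muleA (_^-1%:E)%E) invD !mul1e.
Qed.
(** * Gaussian tails and the union bound *)

Lemma std_normal_pdfE (R : realType) (y : R) :
  normal_pdf 0 1 y = normal_peak 1 * expR (- (y ^+ 2) / 2).
Proof. by rewrite normal_pdfE ?oner_eq0//= /normal_fun subr0 expr1n. Qed.

(** Mills' bound on the upper tail.  The factor [x^-1] matters: it is what makes
    [p] such events of level [sqrt (2 * ln p)] jointly negligible. *)
Lemma std_normal_tail (R : realType) (x : R) : 0 < x ->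
  (std R `]x, +oo[ <= (normal_peak 1 * expR (- (x ^+ 2) / 2) / x)%:E)%E.
Proof.
move=> x0; set K : R := normal_peak 1.
have K0 : 0 <= K by exact: normal_peak_ge0.
pose F (y : R) : R := - (K / x) * expR (- (y ^+ 2) / 2).
pose f (y : R) : R := y / x * (K * expR (- (y ^+ 2) / 2)).
have dF (y : R) : is_derive y (1 : R) F (f y).
  pose g (z : R) : R := - (z ^+ 2) / 2.
  have dg : is_derive y (1 : R) g (- y).
    by apply: is_derive_eq; rewrite /GRing.scale/=; field.
  have dh := @is_derive1_comp _ expR g y _ _ (is_derive_expR (g y)) dg.
  have dZ := is_deriveZ (- (K / x)) dh.
  apply: (is_derive_eq dZ); rewrite /f /g /GRing.scale/=; field; exact: lt0r_neq0.
have cf : continuous f.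
  move=> y; apply: cvgM; first by apply: cvgM; [exact: cvg_id|exact: cvg_cst].
  apply: cvgM; first exact: cvg_cst.
  apply: (cvg_comp _ expR); last exact: continuous_expR.
  apply: cvgM; last exact: cvg_cst.
  by apply: (@cvgN _ R^o); exact: sqr_continuous.
have cF : continuous F.
  by move=> y; apply/differentiable_continuous/derivable1_diffP; apply: ex_derive.
have F0 : F y @[y --> +oo] --> (0 : R).
  rewrite -(mulr0 (- (K / x))); apply: cvgM; first exact: cvg_cst.
  under eq_cvg do rewrite mulNr.
  apply: (cvg_comp (fun y : R => y ^+ 2 / 2) (fun y => expR (- y))).
    apply: gt0_cvgMly; first by rewrite invr_gt0.
    exact: cvgr_expr2.
  exact: cvgr_expR.
have f0 y : x <= y -> 0 <= f y.
  move=> xy; have y0 := lt_le_trans x0 xy.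
  by rewrite mulr_ge0 ?divr_ge0 ?(ltW y0) ?(ltW x0)// mulr_ge0// expR_ge0.
have FTC : (\int[lebesgue_measure]_(y in `[x, +oo[) (f y)%:E = 0%:E - (F x)%:E)%E.
  apply: ge0_continuous_FTC2y => //.
  - exact: continuous_subspaceT.
  - exact: cvg_at_right_filter (cF x).
  - by move=> y _; rewrite derive1E; apply: derive_val.
have -> : K * expR (- (x ^+ 2) / 2) / x = 0 - F x.
  by rewrite /F; field; exact: lt0r_neq0.
rewrite EFinB -FTC /normal_prob.
apply: (@le_trans _ _ (\int[lebesgue_measure]_(y in `[x, +oo[) (normal_pdf 0 1 y)%:E)%E).
  apply: ge0_subset_integral => //=.
  - by apply/measurable_EFinP/measurable_funTS; exact: measurable_normal_pdf.
  - by move=> y _; rewrite lee_fin normal_pdf_ge0.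
  - by move=> y /=; rewrite !in_itv/= !andbT => /ltW.
apply: ge0_le_integral => //=.
- by move=> y _; rewrite lee_fin normal_pdf_ge0.
- by apply/measurable_EFinP/measurable_funTS; exact: measurable_normal_pdf.
- by apply/measurable_EFinP/measurable_funTS; exact: continuous_measurable_fun.
- move=> y; rewrite /= in_itv/= andbT lee_fin std_normal_pdfE => xy.
  by rewrite /f ler_peMl ?mulr_ge0 ?expR_ge0// ler_pdivlMr// mul1r.
Qed.

Lemma std_normal_two_sided_tail (R : realType) (x : R) : 0 < x ->
  (std R [set z | x < `|z|%R]%R <= (2 * (normal_peak 1 * expR (- (x ^+ 2) / 2) / x))%:E)%E.
Proof.
move=> x0.
have mE : measurable (`]x, +oo[%classic : set (measurableTypeR R)) by [].
have mE' : measurable ((fun z => -1 * z + 0) @^-1` `]x, +oo[%classic : set (measurableTypeR R)).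
  by rewrite -[X in measurable X]setTI; exact: measurable_affine.
have -> : [set z : R | x < `|z|] = `]x, +oo[%classic `|`
    ((fun z => -1 * z + 0) @^-1` `]x, +oo[%classic).
  apply/seteqP; split => z /=; rewrite !in_itv/= !andbT addr0 mulN1r lter_normr.
    by move/orP.
  by move=> ?; apply/orP.
apply: le_trans (measureU2 _ mE mE') _.
have N10 : -1 != 0 :> R by rewrite oppr_eq0 oner_eq0.
have e : std R `]x, +oo[%classic = std R ((fun z => -1 * z + 0) @^-1` `]x, +oo[%classic).
  rewrite -(normal_prob_affine 0 N10 mE) /normal_prob.
  apply: eq_integral => z _; congr EFin; rewrite !normal_pdfE ?oner_eq0//=.
  by rewrite /normal_peak /normal_fun sqrrN.
have tail := std_normal_tail x0.
rewrite mulr_natl mulr2n EFinD; apply: leeD; first exact: tail.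
by move: tail; rewrite e.
Qed.

(** Simultaneous control of [p] normalized Gaussian linear statistics. *)
Lemma gaussian_max_bound (R : realType) (d : measure_display)
    (Omega : measurableType d) (P : probability Omega R)
    (eps : nat -> {RV P >-> R}) (s : R) (n p : nat) (Z : 'M[R]_(n, p)) (x : R) :
  0 < s -> mutually_independent eps -> (forall i, is_normal (eps i) 0 s) ->
  (forall j, \sum_(i < n) Z i j ^+ 2 = 1) -> 0 < x ->
  let G := [set w | forall j : 'I_p, `|\sum_(i < n) Z i j * eps i w| <= s * x] in
  measurable G /\
  (P (~` G) <= (p%:R * (2 * (normal_peak 1 * expR (- (x ^+ 2) / 2) / x)))%:E)%E.
Proof.
move=> s0 indep Neps Z1 x0 G.
have sN0 : s != 0 by exact: lt0r_neq0.
pose bad (j : 'I_p) : set Omega := [set w | s * x < `|\sum_(i < n) Z i j * eps i w|].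
(* the coefficients of column [j], extended by zero to all indices *)
pose v (j : 'I_p) (i : nat) : R := if insub i is Some i' then Z i' j else 0.
have vE j (i : 'I_n) : v j i = Z i j by rewrite /v valK.
pose E : set (measurableTypeR R) := [set z | s * x < `|z|].
have mE : measurable E.
  have -> : E = (fun z : measurableTypeR R => `|z|) @^-1` `]s * x, +oo[%classic.
    by apply/seteqP; split => z /=; rewrite /E/= in_itv/= andbT.
  have mn : measurable_fun [set: measurableTypeR R] ((fun z => `|z|) : _ -> measurableTypeR R).
    exact: measurableT_comp.
  by rewrite -[X in measurable X]setTI; exact: mn.
have badE j : bad j = (fun w => \sum_(i < n) v j i * eps i w) @^-1` E.
  have vs w : \sum_(i < n) v j i * eps i w = \sum_(i < n) Z i j * eps i w.
    by apply: eq_bigr => i _; rewrite vE.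
  by apply/seteqP; split => w /=; rewrite /bad/E/= vs.
have mbad j : measurable (bad j).
  have ms : measurable_fun [set: Omega]
      ((fun w => \sum_(i < n) v j i * eps i w) : _ -> measurableTypeR R).
    by apply: measurable_sum => i; apply: measurable_funM.
  by rewrite badE -[X in measurable X]setTI; exact: ms.
have Pbad j : (P (bad j) <= (2 * (normal_peak 1 * expR (- (x ^+ 2) / 2) / x))%:E)%E.
  have := @gaussian_sum_law _ _ _ P eps s (v j) sN0 indep Neps n E [::] (fun=> setT) mE isT isT
    (fun=> measurableT).
  rewrite big_nil mule1 (_ : [set` [::]] = set0); last by apply/seteqP; split.
  rewrite bigcap_set0 setIT -badE => ->.
  apply: le_trans (std_normal_two_sided_tail x0).
  rewrite le_eqVlt; apply/orP; left; apply/eqP; apply: (f_equal (std R)).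
  have -> : \sum_(i < n) (v j i * s) ^+ 2 = s ^+ 2.
    by under eq_bigr do rewrite vE exprMn; rewrite -mulr_suml Z1 mul1r.
  rewrite sqrtr_sqr gtr0_norm//; apply/seteqP; split => z;
    by rewrite /E /= normrM gtr0_norm// ltr_pM2l.
pose bad' (k : nat) : set Omega := if insub k is Some j then bad j else set0.
have bad'E (j : 'I_p) : bad' j = bad j by rewrite /bad' valK.
have mbad' k : measurable (bad' k) by rewrite /bad'; case: insub.
have GE : ~` G = \big[setU/set0]_(j < p) bad' j.
  rewrite -bigcup_mkord; apply/seteqP; split => w /=.
    move/existsNP => [j /negP]; rewrite -ltNge => jw.
    by exists j => //=; rewrite bad'E.
  move=> [k /= kp]; rewrite -[k]/(val (Ordinal kp)) bad'E /bad /= => jw Gw.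
  by have := Gw (Ordinal kp); rewrite leNgt jw.
have mG : measurable (~` G) by rewrite GE; exact: bigsetU_measurable.
split; first by rewrite -(setCK G); exact: measurableC.
rewrite GE; apply: (@le_trans _ _ (\sum_(j < p) P (bad' j))%E).
  exact: Boole_inequality.
apply: (@le_trans _ _ (\sum_(j < p) (2 * (normal_peak 1 * expR (- (x ^+ 2) / 2) / x))%:E)%E).
  by apply: lee_sum => j _; rewrite bad'E.
by rewrite sumEFin sumr_const card_ord lee_fin -[X in X <= _]mulr_natl.
Qed.

(** * Euclidean vectors and the restricted isometry constants *)

Lemma cauchy_schwarz_sum (R : realType) (I : finType) (A : pred I) (u v : I -> R) :
  (\sum_(i | A i) u i * v i) ^+ 2 <=
  (\sum_(i | A i) u i ^+ 2) * (\sum_(i | A i) v i ^+ 2).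
Proof.
rewrite -subr_ge0.
have H : 0 <= \sum_(i | A i) \sum_(j | A j) (u i * v j - u j * v i) ^+ 2.
  by apply: sumr_ge0 => i _; apply: sumr_ge0 => j _; exact: sqr_ge0.
have E : \sum_(i | A i) \sum_(j | A j) (u i * v j - u j * v i) ^+ 2 =
   2 * ((\sum_(i | A i) u i ^+ 2) * (\sum_(i | A i) v i ^+ 2) - (\sum_(i | A i) u i * v i) ^+ 2).
  transitivity (\sum_(i | A i) \sum_(j | A j)
     (u i ^+ 2 * v j ^+ 2 + v i ^+ 2 * u j ^+ 2 - 2 * (u i * v i) * (u j * v j))).
    by apply: eq_bigr => i _; apply: eq_bigr => j _; ring.
  under eq_bigr => i _ do rewrite sumrB big_split/= -!mulr_sumr.
  rewrite sumrB big_split/= -!mulr_suml -!mulr_sumr expr2; ring.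
by move: H; rewrite E pmulr_rge0.
Qed.

Lemma l2norm_ge0 (R : realType) (k : nat) (v : 'cV[R]_k) : 0 <= l2norm v.
Proof. exact: sqrtr_ge0. Qed.

Lemma l2norm_sqr (R : realType) (k : nat) (v : 'cV[R]_k) :
  l2norm v ^+ 2 = \sum_j v j 0 ^+ 2.
Proof. by rewrite sqr_sqrtr//; apply: sumr_ge0 => j _; exact: sqr_ge0. Qed.

Lemma l2norm_sqr_dotv (R : realType) (k : nat) (v : 'cV[R]_k) :
  l2norm v ^+ 2 = dotv v v.
Proof. by rewrite l2norm_sqr; apply: eq_bigr => j _; rewrite expr2. Qed.

Lemma l2norm_eq0 (R : realType) (k : nat) (v : 'cV[R]_k) :
  (l2norm v == 0) = (v == 0).
Proof.
apply/eqP/eqP => [v0|->]; last first.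
  by rewrite /l2norm big1 ?sqrtr0// => j _; rewrite mxE expr0n.
apply/colP => j; rewrite mxE; apply/eqP; rewrite -sqrf_eq0 eq_le sqr_ge0 andbT.
rewrite -[leRHS](expr0n R 2) -v0 l2norm_sqr (bigD1 j)//= lerDl.
by apply: sumr_ge0 => i _; exact: sqr_ge0.
Qed.

Lemma cauchy_schwarz (R : realType) (k : nat) (u v : 'cV[R]_k) :
  `|dotv u v| <= l2norm u * l2norm v.
Proof.
rewrite -(@ler_pXn2r _ 2)// ?nnegrE ?mulr_ge0 ?l2norm_ge0//.
rewrite real_normK ?num_real// exprMn !l2norm_sqr.
exact: (cauchy_schwarz_sum predT (fun j => u j 0) (fun j => v j 0)).
Qed.

Lemma dotvC (R : realType) (k : nat) (u v : 'cV[R]_k) : dotv u v = dotv v u.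
Proof. by apply: eq_bigr => j _; rewrite mulrC. Qed.

Lemma dotvDr (R : realType) (k : nat) (u v w : 'cV[R]_k) :
  dotv u (v + w) = dotv u v + dotv u w.
Proof. by rewrite -big_split; apply: eq_bigr => j _; rewrite mxE mulrDr. Qed.

Lemma dotvDl (R : realType) (k : nat) (u v w : 'cV[R]_k) :
  dotv (v + w) u = dotv v u + dotv w u.
Proof. by rewrite dotvC dotvDr !(dotvC u). Qed.

Lemma dotvNr (R : realType) (k : nat) (u v : 'cV[R]_k) : dotv u (- v) = - dotv u v.
Proof. by rewrite -sumrN; apply: eq_bigr => j _; rewrite mxE mulrN. Qed.

Lemma dotvBr (R : realType) (k : nat) (u v w : 'cV[R]_k) :
  dotv u (v - w) = dotv u v - dotv u w.
Proof. by rewrite dotvDr dotvNr. Qed.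

Lemma dotvZr (R : realType) (k : nat) (a : R) (u v : 'cV[R]_k) :
  dotv u (a *: v) = a * dotv u v.
Proof. by rewrite mulr_sumr; apply: eq_bigr => j _; rewrite mxE mulrCA. Qed.

(** Adjunction between a matrix and its columns. *)
Lemma dotv_mulmx (R : realType) (n p : nat) (Z : 'M[R]_(n, p)) (h : 'cV[R]_p)
    (y : 'cV[R]_n) :
  dotv (Z *m h) y = \sum_j h j 0 * dotv (col j Z) y.
Proof.
rewrite /dotv; under eq_bigr do rewrite mxE mulr_suml.
rewrite exchange_big/=; apply: eq_bigr => j _; rewrite mulr_sumr.
by apply: eq_bigr => i _; rewrite mxE mulrCA mulrA.
Qed.

(** If every element of [D] bounds [x] after multiplication by [y], so does its
    infimum.  This transfers the inequalities defining [delta_rip] and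
    [theta_rip] to these infima. *)
Lemma le_inf_mul (R : realType) (D : set R) (x y : R) :
  D !=set0 -> 0 <= y -> (forall d, D d -> x <= d * y) -> x <= inf D * y.
Proof.
move=> D0 y0 Dx; have [y00|yN0] := eqVneq y 0.
  by case: D0 => d /Dx; rewrite y00 !mulr0.
have yp : 0 < y by rewrite lt_neqAle eq_sym yN0.
rewrite -ler_pdivrMr//; apply: lb_le_inf => // d /Dx.
by rewrite ler_pdivrMr.
Qed.

Lemma l2norm_mulmx_le (R : realType) (n p : nat) (Z : 'M[R]_(n, p)) (c : 'cV[R]_p) :
  l2norm (Z *m c) ^+ 2 <= (\sum_i \sum_j Z i j ^+ 2) * l2norm c ^+ 2.
Proof.
rewrite !l2norm_sqr mulr_suml; apply: ler_sum => i _; rewrite mxE.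
exact: (cauchy_schwarz_sum predT (fun j => Z i j) (fun j => c j 0)).
Qed.

(** The vector [h] with the coordinates outside [T] set to zero. *)
Definition restr (R : realType) (p : nat) (T : {set 'I_p}) (h : 'cV[R]_p) :
  'cV[R]_p := \col_j (if j \in T then h j 0 else 0).

Lemma sum_restr_sqr (R : realType) (p : nat) (T : {set 'I_p}) (h : 'cV[R]_p) :
  l2norm (restr T h) ^+ 2 = \sum_(j in T) h j 0 ^+ 2.
Proof.
rewrite l2norm_sqr [RHS]big_mkcond; apply: eq_bigr => j _; rewrite mxE.
by case: ifP; rewrite // expr0n.
Qed.

Lemma std_sub_restr (R : realType) (n p : nat) (V : 'M[R]_(n, p))
    (T : {set 'I_p}) (h : 'cV[R]_p) :
  let c : 'cV[R]_#|T| := \col_k h (enum_val k) 0 in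
  std_sub V T *m c = std_cols V *m restr T h /\ l2norm c = l2norm (restr T h).
Proof.
move=> c; split.
  apply/colP => i; rewrite !mxE.
  rewrite [RHS](eq_bigr (fun j => if j \in T then std_cols V i j * h j 0 else 0)).
    rewrite -big_mkcond [RHS]big_enum_val/=; apply: eq_bigr => k _.
    by rewrite !mxE.
  by move=> j _; rewrite [restr _ _ _ _]mxE; case: ifP; rewrite ?mulr0.
congr Num.sqrt; rewrite -[RHS]l2norm_sqr sum_restr_sqr [RHS]big_enum_val/=.
by apply: eq_bigr => k _; rewrite !mxE.
Qed.

Lemma std_sub_frob (R : realType) (n p : nat) (V : 'M[R]_(n, p)) (T : {set 'I_p}) :
  \sum_i \sum_k std_sub V T i k ^+ 2 <= \sum_i \sum_j std_cols V i j ^+ 2.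
Proof.
apply: ler_sum => i _.
rewrite [leLHS](eq_bigr (fun k : 'I_#|T| => std_cols V i (enum_val k) ^+ 2)).
  have -> : \sum_(k < #|T|) std_cols V i (enum_val k) ^+ 2 =
      \sum_(j in T) std_cols V i j ^+ 2 by rewrite [RHS]big_enum_val.
  rewrite [leRHS](bigID (mem T))/= lerDl.
  by apply: sumr_ge0 => j _; exact: sqr_ge0.
by move=> k _; rewrite mxE.
Qed.

Lemma delta_rip_lower (R : realType) (n p S : nat) (V : 'M[R]_(n, p))
    (T : {set 'I_p}) (h : 'cV[R]_p) : (#|T| <= S)%N ->
  (1 - delta_rip S V) * l2norm (restr T h) ^+ 2 <= l2norm (std_cols V *m restr T h) ^+ 2.
Proof.
move=> TS; have [<- cn] := std_sub_restr V T h.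
rewrite -cn mulrBl mul1r lerBlDr -lerBlDl.
apply: le_inf_mul; last 2 first.
- exact: sqr_ge0.
- move=> d [_ /(_ T _ TS)]; set c := (X in std_sub V T *m X) => /(_ c) /andP[+ _].
  by rewrite mulrBl mul1r lerBlDr -lerBlDl.
pose K := \sum_i \sum_j std_cols V i j ^+ 2.
have K0 : 0 <= K by apply: sumr_ge0 => i _; apply: sumr_ge0 => j _; exact: sqr_ge0.
exists (1 + K); split; first by rewrite addr_ge0.
move=> T' c _; apply/andP; split.
  apply: (@le_trans _ _ 0); last exact: sqr_ge0.
  by rewrite mulr_le0_ge0 ?sqr_ge0// opprD addrA subrr sub0r oppr_le0.
apply: (le_trans (l2norm_mulmx_le _ _)); rewrite ler_wpM2r ?sqr_ge0//.
apply: (le_trans (std_sub_frob _ _)); rewrite -/K; lra.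
Qed.

Lemma theta_rip_bound (R : realType) (n p S S' : nat) (V : 'M[R]_(n, p))
    (T T' : {set 'I_p}) (h h' : 'cV[R]_p) :
  (#|T| <= S)%N -> (#|T'| <= S')%N -> [disjoint T & T']%bool ->
  `|dotv (std_cols V *m restr T h) (std_cols V *m restr T' h')| <=
  theta_rip S S' V * (l2norm (restr T h) * l2norm (restr T' h')).
Proof.
move=> TS TS' dT; have [<- cn] := std_sub_restr V T h.
have [<- cn'] := std_sub_restr V T' h'.
rewrite -cn -cn'; apply: le_inf_mul; last 2 first.
- by rewrite mulr_ge0 ?l2norm_ge0.
- by move=> d [_ dP]; rewrite mulrA; exact: dP.
pose K := \sum_i \sum_j std_cols V i j ^+ 2.
have K0 : 0 <= K by apply: sumr_ge0 => i _; apply: sumr_ge0 => j _; exact: sqr_ge0.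
have bd (U : {set 'I_p}) (c : 'cV[R]_#|U|) :
    l2norm (std_sub V U *m c) <= Num.sqrt K * l2norm c.
  rewrite -(@ler_pXn2r _ 2)// ?nnegrE ?mulr_ge0 ?sqrtr_ge0 ?l2norm_ge0//.
  rewrite exprMn (sqr_sqrtr K0); apply: (le_trans (l2norm_mulmx_le _ _)).
  by rewrite ler_wpM2r ?sqr_ge0// std_sub_frob.
exists K; split => // U U' c c' _ _ _.
apply: (le_trans (cauchy_schwarz _ _)).
apply: (le_trans (ler_pM (l2norm_ge0 _) (l2norm_ge0 _) (bd _ c) (bd _ c'))).
by rewrite mulrACA -expr2 (sqr_sqrtr K0) mulrA.
Qed.

Lemma theta_rip_ge0 (R : realType) (n p S S' : nat) (V : 'M[R]_(n, p)) :
  0 <= theta_rip S S' V.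
Proof.
rewrite /theta_rip; set D := [set d | _].
have [D0|/nonemptyPn ->] := pselect (D !=set0); last by rewrite inf0.
by apply: lb_le_inf => // d [].
Qed.
(** * Sparse recovery by the Dantzig selector *)

(** A set [U] of at most [S] of the largest entries of [a] on [A], together with
    a threshold [M] separating them from the other entries. *)
Lemma top_entries (R : realType) (I : finType) (a : I -> R) (A : {set I}) (S : nat) :
  (forall i, 0 <= a i) ->
  exists (U : {set I}) (M : R),
    [/\ U \subset A, (#|U| <= S)%N, 0 <= M,
        forall i, i \in A :\: U -> a i <= M & S%:R * M <= \sum_(i in U) a i].
Proof.
move=> a0; elim: S => [|S [U [M [UA US M0 aM SM]]]].
  exists finset.set0, (\sum_i a i); split; rewrite ?finset.sub0set ?cards0//.
  - exact: sumr_ge0.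
  - by move=> i _; rewrite (bigD1 i)//= lerDl sumr_ge0.
  - by rewrite mul0r big_set0.
have [AU0|[i0 i0AU]] := set_0Vmem (A :\: U).
  exists U, 0; split; rewrite ?mulr0 ?sumr_ge0// ?(leqW US)//.
  by move=> i; rewrite AU0 inE.
have [i iAU imax] := @arg_maxP _ _ _ i0 (mem (A :\: U)) a i0AU.
have {}iAU : i \in A :\: U by exact: iAU.
have /andP[iU iA] : (i \notin U) && (i \in A) by rewrite -finset.in_setD.
exists (i |: U), (a i); split => //.
- by rewrite finset.subUset UA andbT finset.sub1set.
- by rewrite cardsU1 iU add1n ltnS.
- move=> k; rewrite finset.setUC -finset.setDDl 2!inE => /andP[_ kAU]; exact: imax.
- rewrite big_setU1//= -natr1 mulrDl mul1r [leLHS]addrC lerD2l.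
  by apply: le_trans SM; rewrite ler_wpM2l// aM.
Qed.

Lemma restr_split (R : realType) (p : nat) (A U : {set 'I_p}) (h : 'cV[R]_p) :
  U \subset A -> restr A h = restr U h + restr (A :\: U) h.
Proof.
move=> /fintype.subsetP UA; apply/colP => j; rewrite !mxE !inE.
by case: (boolP (j \in U)) => [/UA ->|_] /=; rewrite ?addr0 ?add0r.
Qed.

Lemma sum_setD (R : realType) (I : finType) (a : I -> R) (A U : {set I}) :
  U \subset A -> \sum_(i in A) a i = \sum_(i in U) a i + \sum_(i in A :\: U) a i.
Proof. by move=> /finset.setIidPr AU; rewrite (big_setID U)/= AU. Qed.

Lemma sum_sqr_le (R : realType) (I : finType) (a : I -> R) (A : {set I}) (M : R) :
  (forall i, 0 <= a i) -> (forall i, i \in A -> a i <= M) ->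
  \sum_(i in A) a i ^+ 2 <= M * \sum_(i in A) a i.
Proof.
move=> a0 aM; rewrite mulr_sumr; apply: ler_sum => i iA.
by rewrite expr2 ler_wpM2r ?aM.
Qed.

(** The interaction of an [S']-sparse vector with a vector supported on a disjoint
    set [A] of any size, all of whose entries are at most [M].  The set [A] is cut
    into blocks of [S] entries of decreasing size.  The l2 norm of a block is at
    most [sqrt S] times its largest entry; for the first block this is the term
    in [M], and for every later one it is at most the l1 norm of the preceding
    block divided by [sqrt S]. *)
Lemma theta_block_bound (R : realType) (n p S S' : nat) (V : 'M[R]_(n, p))
    (T : {set 'I_p}) (g h : 'cV[R]_p) :
  (0 < S)%N -> (#|T| <= S')%N ->
  forall (A : {set 'I_p}) (M : R), [disjoint A & T]%bool -> 0 <= M ->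
  (forall j, j \in A -> `|h j 0| <= M) ->
  `|dotv (std_cols V *m restr A h) (std_cols V *m restr T g)| <=
  theta_rip S S' V * l2norm (restr T g) *
    ((S%:R * M + \sum_(j in A) `|h j 0|) / Num.sqrt S%:R).
Proof.
move=> S0 TS' A; move: {2}#|A|.+1 (ltnSn #|A|) => k.
have sS0 : 0 < Num.sqrt S%:R :> R by rewrite sqrtr_gt0 ltr0n.
have th0 := theta_rip_ge0 S S' V.
have C0 : 0 <= theta_rip S S' V * l2norm (restr T g) by rewrite mulr_ge0 ?l2norm_ge0.
elim: k A => // k IH A; rewrite ltnS => Ak M dAT M0 hM.
have [->|[j0 j0A]] := set_0Vmem A.
  have -> : restr finset.set0 h = 0 by apply/colP => j; rewrite !mxE inE.
  rewrite mulmx0 /dotv big1 ?normr0; last by move=> i _; rewrite mxE mul0r.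
  by rewrite big_set0 addr0 mulr_ge0// divr_ge0 ?mulr_ge0// ltW.
have [U [M' [UA US M'0 hM' SM']]] :=
  @top_entries _ _ (fun j => `|h j 0|) A S (fun j => normr_ge0 _).
have [U0|[j1 j1U]] := set_0Vmem U.
  (* an empty [U] forces [M' = 0], so that [h] vanishes on [A] *)
  have hA j : j \in A -> h j 0 = 0.
    move=> jA; move: SM'; rewrite U0 big_set0 pmulr_rle0 ?ltr0n// => M'le0.
    apply/eqP; rewrite -normr_le0; apply: le_trans M'le0.
    by apply: hM'; rewrite U0 finset.setD0.
  have -> : restr A h = 0 by apply/colP => j; rewrite !mxE; case: ifP => // /hA.
  rewrite mulmx0 /dotv big1 ?normr0; last by move=> i _; rewrite mxE mul0r.
  by rewrite mulr_ge0// divr_ge0 ?addr_ge0 ?mulr_ge0 ?sumr_ge0// ltW.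
have AUk : (#|A :\: U| < k)%N.
  apply: leq_trans Ak; apply: proper_card; apply/properP; split; first exact: finset.subsetDl.
  by exists j1; [exact: (fintype.subsetP UA)|rewrite inE j1U].
have dAUT : [disjoint A :\: U & T]%bool by apply: disjointWl dAT; exact: finset.subsetDl.
have dUT : [disjoint U & T]%bool by exact: disjointWl dAT.
(* [U] is the first block; its l1 norm pays for the term in [M'] of the rest *)
rewrite (restr_split _ UA) mulmxDr dotvDl; apply: (le_trans (ler_normD _ _)).
rewrite (sum_setD _ UA) mulrDl mulrDr lerD//.
  apply: (le_trans (theta_rip_bound _ _ _ US TS' dUT)).
  rewrite [l2norm (restr U h) * _]mulrC [leLHS]mulrA ler_wpM2l//.
  rewrite -(@ler_pXn2r _ 2)// ?nnegrE ?l2norm_ge0 ?divr_ge0 ?mulr_ge0 ?(ltW sS0)//.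
  rewrite sum_restr_sqr exprMn exprVn (sqr_sqrtr (ler0n _ _)).
  have -> : (S%:R * M) ^+ 2 / S%:R = S%:R * M ^+ 2.
    by field; rewrite pnatr_eq0 -lt0n.
  apply: (@le_trans _ _ (\sum_(j in U) M ^+ 2)).
    apply: ler_sum => j jU; rewrite -(real_normK (num_real (h j 0))).
    by rewrite lerXn2r ?nnegrE//; apply: hM; exact: (fintype.subsetP UA).
  by rewrite sumr_const -[leLHS]mulr_natl ler_wpM2r ?sqr_ge0// ler_nat.
apply: (le_trans (IH _ AUk M' dAUT M'0 hM')).
by rewrite ler_wpM2l// ler_wpM2r ?invr_ge0 ?(ltW sS0)// lerD2r.
Qed.
Lemma sum_abs_sqr_le (R : realType) (I : finType) (a : I -> R) (A : {set I}) :
  (\sum_(i in A) `|a i|) ^+ 2 <= #|A|%:R * \sum_(i in A) a i ^+ 2.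
Proof.
have := cauchy_schwarz_sum (mem A) (fun=> 1) (fun i => `|a i|).
under [in X in X ^+ 2 <= _]eq_bigr do rewrite mul1r.
move=> /le_trans; apply; rewrite sumr_const expr1n.
by under eq_bigr do rewrite real_normK ?num_real//.
Qed.

(** The estimate of Candes and Tao: a vector with at least half of its l1 mass on
    at most [S] coordinates, and whose image has small correlations with the columns of
    the design, is small in l2 norm. *)
Lemma cone_l2_bound (R : realType) (n p S : nat) (V : 'M[R]_(n, p))
    (T0 : {set 'I_p}) (h : 'cV[R]_p) (mu : R) :
  (#|T0| <= S)%N -> 0 <= mu ->
  delta_rip (2 * S) V + theta_rip S (2 * S) V < 1 ->
  \sum_(j in ~: T0) `|h j 0| <= \sum_(j in T0) `|h j 0| ->
  (forall j, `|dotv (col j (std_cols V)) (std_cols V *m h)| <= mu) ->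
  (1 - (delta_rip (2 * S) V + theta_rip S (2 * S) V)) * l2norm h <=
    2 * Num.sqrt S%:R * mu.
Proof.
set dl := delta_rip _ _; set th := theta_rip _ _ _; set Z := std_cols V.
move=> T0S mu0 dth cone corr.
have th0 : 0 <= th by exact: theta_rip_ge0.
have [S0|S0] := posnP S.
  have T00 : T0 = finset.set0 by apply/eqP; rewrite -cards_eq0 -leqn0 -S0.
  have h0 : h = 0.
    apply/colP => j; rewrite mxE; apply/eqP; rewrite -normr_le0.
    move: cone; rewrite T00 big_set0 finset.setC0; apply: le_trans.
    by rewrite (bigD1 j) ?finset.in_setT//= lerDl sumr_ge0.
  have -> : l2norm h = 0 by apply/eqP; rewrite l2norm_eq0 h0.
  by rewrite mulr0 mulr_ge0// mulr_ge0// sqrtr_ge0.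
have SR0 : 0 < S%:R :> R by rewrite ltr0n.
set s := Num.sqrt S%:R.
have s0 : 0 < s by rewrite sqrtr_gt0.
have s2 : s ^+ 2 = S%:R by rewrite sqr_sqrtr ?ler0n.
have [U [M [UT US M0 hM SM]]] :=
  @top_entries _ _ (fun j => `|h j 0|) (~: T0) S (fun j => normr_ge0 _).
(* [T1] adds to [T0] the [S] largest other entries; [A] is the remaining set *)
set T1 := T0 :|: U; set A := ~: T0 :\: U.
have AE : A = ~: T1 by rewrite /A /T1 finset.setDE -finset.setCU.
have T1S : (#|T1| <= 2 * S)%N.
  by rewrite mul2n -addnn (leq_trans (leq_card_setU _ _))// leq_add.
have hE : h = restr T1 h + restr A h.
  by apply/colP => j; rewrite !mxE AE finset.in_setC; case: (_ \in _); rewrite ?addr0 ?add0r.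
set x := l2norm (restr T1 h); have x0 : 0 <= x by exact: l2norm_ge0.
set a := \sum_(j in T0) `|h j 0|.
have a0 : 0 <= a by exact: sumr_ge0.
have T0x : \sum_(j in T0) h j 0 ^+ 2 <= x ^+ 2.
  rewrite sum_restr_sqr (@sum_setD _ _ _ T1 T0) ?finset.subsetUl// lerDl.
  by apply: sumr_ge0 => j _; exact: sqr_ge0.
have a2 : a ^+ 2 <= S%:R * x ^+ 2.
  apply: (le_trans (sum_abs_sqr_le _ _)); apply: ler_pM => //.
  - by apply: sumr_ge0 => j _; exact: sqr_ge0.
  - by rewrite ler_nat.
have a1 : a <= s * x.
  rewrite -(@ler_pXn2r _ 2)// ?nnegrE ?mulr_ge0 ?(ltW s0)//.
  by rewrite exprMn s2.
have UA : \sum_(j in U) `|h j 0| + \sum_(j in A) `|h j 0| <= a.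
  by rewrite -sum_setD.
have U0 : 0 <= \sum_(j in U) `|h j 0| by exact: sumr_ge0.
have A0 : 0 <= \sum_(j in A) `|h j 0| by exact: sumr_ge0.
have inner1 : dotv (Z *m restr T1 h) (Z *m h) <= mu * (Num.sqrt 2 * s * x).
  apply: (le_trans (ler_norm _)); rewrite dotv_mulmx.
  apply: (@le_trans _ _ (mu * \sum_(j in T1) `|h j 0|)).
    rewrite mulr_sumr [leRHS]big_mkcond/=; apply: (le_trans (ler_norm_sum _ _ _)).
    apply: ler_sum => j _; rewrite mxE normrM; case: ifP => _.
      by rewrite mulrC ler_wpM2r.
    by rewrite normr0 mul0r.
  rewrite ler_wpM2l// -(@ler_pXn2r _ 2)// ?nnegrE ?mulr_ge0 ?sqrtr_ge0 ?sumr_ge0 ?(ltW s0)//.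
  apply: (le_trans (sum_abs_sqr_le _ _)).
  rewrite !exprMn s2 (sqr_sqrtr (ler0n _ 2)) -natrM sum_restr_sqr.
  by rewrite ler_wpM2r ?ler_nat// sumr_ge0// => j _; exact: sqr_ge0.
have dAT1 : [disjoint A & T1]%bool by rewrite AE disjoint_sym finset.disjoints_subset finset.setCK.
have inner2 : `|dotv (Z *m restr A h) (Z *m restr T1 h)| <= th * x * x.
  apply: (le_trans (@theta_block_bound _ _ _ S _ V T1 h h S0 T1S A M dAT1 M0 hM)).
  rewrite -/th -/x ler_wpM2l ?mulr_ge0// ler_pdivrMr// [leRHS]mulrC.
  apply: le_trans a1; apply: le_trans UA; by rewrite lerD2r.
have main : (1 - (dl + th)) * x ^+ 2 <= mu * (Num.sqrt 2 * s * x).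
  have := @delta_rip_lower _ _ _ (2 * S) V T1 h T1S.
  rewrite -/dl -/x -/Z l2norm_sqr_dotv => low.
  have E : dotv (Z *m restr T1 h) (Z *m h) = dotv (Z *m restr T1 h) (Z *m restr T1 h)
      + dotv (Z *m restr A h) (Z *m restr T1 h).
    by rewrite {2}hE mulmxDr dotvDr [dotv _ (Z *m restr A h)]dotvC.
  move: inner1; rewrite E => inner1.
  have := ler_norm (- dotv (Z *m restr A h) (Z *m restr T1 h)); rewrite normrN.
  move=> /le_trans /(_ inner2) inner2'; nra.
have hx : l2norm h <= Num.sqrt 2 * x.
  rewrite -(@ler_pXn2r _ 2)// ?nnegrE ?mulr_ge0 ?sqrtr_ge0 ?l2norm_ge0//.
  rewrite exprMn (sqr_sqrtr (ler0n _ 2)) l2norm_sqr.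
  rewrite (bigID (mem T1))/= -sum_restr_sqr -/x.
  have -> : \sum_(j | j \notin T1) h j 0 ^+ 2 = \sum_(j in A) `|h j 0| ^+ 2.
    apply: eq_big => [j|j _]; first by rewrite AE finset.in_setC.
    by rewrite real_normK ?num_real.
  have := @sum_sqr_le _ _ (fun j => `|h j 0|) A M (fun j => normr_ge0 _) hM.
  move=> h2; rewrite mulrC mulr_natr mulr2n lerD2l; apply: (le_trans h2).
  rewrite -(ler_pM2l SR0); apply: le_trans a2; rewrite mulrA.
  apply: (le_trans (ler_wpM2r A0 SM)); rewrite expr2; apply: ler_pM => //.
    by apply: le_trans UA; rewrite lerDl.
  by apply: le_trans UA; rewrite lerDr.
have [x00|xN0] := eqVneq x 0.
  have -> : l2norm h = 0 by apply/eqP; rewrite eq_le l2norm_ge0 andbT -(mulr0 (Num.sqrt 2)) -x00.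
  by rewrite mulr0 mulr_ge0// mulr_ge0// sqrtr_ge0.
have xp : 0 < x by rewrite lt_neqAle eq_sym xN0.
have main' : (1 - (dl + th)) * x <= mu * (Num.sqrt 2 * s).
  by rewrite -(ler_pM2r xp) -mulrA -expr2 -!mulrA; move: main; rewrite -!mulrA.
have k0 : 0 <= 1 - (dl + th) by rewrite subr_ge0 ltW.
apply: (le_trans (ler_wpM2l k0 hx)).
rewrite mulrCA; apply: (le_trans (ler_wpM2l (sqrtr_ge0 2) main')).
have : Num.sqrt 2 ^+ 2 = 2 :> R by rewrite sqr_sqrtr.
move=> q2; rewrite le_eqVlt; apply/orP; left; apply/eqP.
by rewrite -[in RHS]q2; ring.
Qed.
(** Deterministic error bound for the Dantzig selector: any sparse feasible
    vector is close to every solution.  The minimality of the l1 norm puts at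
    least half of the l1 mass of the difference on the support of that vector. *)
Lemma dantzig_l2_error (R : realType) (n p S : nat) (V : 'M[R]_(n, p))
    (Y : 'cV[R]_n) (lam : R) (g gam : 'cV[R]_p) :
  0 <= lam -> (nb_nonzero gam <= S)%N ->
  delta_rip (2 * S) V + theta_rip S (2 * S) V < 1 ->
  dantzig_feasible (std_cols V) Y lam gam -> is_dantzig (std_cols V) Y lam g ->
  (1 - (delta_rip (2 * S) V + theta_rip S (2 * S) V)) * l2norm (g - gam) <=
    4 * Num.sqrt S%:R * lam.
Proof.
move=> lam0 gS dth fgam [fg gmin].
have -> : 4 * Num.sqrt S%:R * lam = 2 * Num.sqrt S%:R * (2 * lam) by ring.
apply: (@cone_l2_bound _ _ _ _ _ [set j | gam j 0 != 0]%SET) => //.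
- by rewrite mulr_ge0.
- have := gmin _ fgam; rewrite /l1norm.
  rewrite (bigID (mem [set j | gam j 0 != 0]%SET))/=.
  rewrite [leRHS](bigID (mem [set j | gam j 0 != 0]%SET))/=.
  rewrite [X in _ <= _ + X]big1 ?addr0; last first.
    by move=> j; rewrite finset.inE negbK => /eqP ->; rewrite normr0.
  have -> : \sum_(j in ~: [set j | gam j 0 != 0]%SET) `|(g - gam) j 0| =
      \sum_(j | j \notin [set j | gam j 0 != 0]%SET) `|g j 0|.
    apply: eq_big => [j|j]; first by rewrite finset.in_setC.
    by rewrite finset.in_setC finset.inE negbK !mxE => /eqP ->; rewrite subr0.
  rewrite -lerBrDl => /le_trans; apply; rewrite -sumrB; apply: ler_sum => j _.
  rewrite !mxE distrC; apply: le_trans (lerB_dist _ _); exact: lexx.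
- move=> j; rewrite (_ : _ *m (g - gam) = (Y - std_cols V *m gam) - (Y - std_cols V *m g)).
    rewrite dotvBr mulr_natl mulr2n; apply: (le_trans (ler_normB _ _)); exact: lerD.
  by rewrite mulmxBr opprB addrCA [X in _ = _ + X]addrAC subrr add0r.
Qed.

(** * Lasso solutions as Dantzig selector solutions *)

(** A linear term that is dominated by a quadratic one near zero is nonpositive. *)
Lemma le0_of_quadratic (R : realType) (q e r : R) : 0 <= q -> 0 < r ->
  (forall t, 0 < t -> t <= r -> t * e <= q * t ^+ 2) -> e <= 0.
Proof.
move=> q0 r0 H; rewrite leNgt; apply/negP => e0.
have q1 : 0 < q + 1 by rewrite ltr_wpDl.
pose t := Num.min r (e / (q + 1)).
have t0 : 0 < t by rewrite lt_min r0 divr_gt0.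
have := H t t0; rewrite ge_min lexx => /(_ isT).
rewrite expr2 mulrCA ler_pM2l// => H'.
have : t <= e / (q + 1) by rewrite ge_min lexx orbT.
rewrite ler_pdivlMr// mulrDr mulr1 mulrC => H''.
by have := lt_le_trans (ltr_pwDr t0 H') H''; rewrite ltxx.
Qed.

(** First-order conditions for the lasso along one coordinate: [a] is the entry of
    the solution, [s] its perturbation, and [c] the residual correlation. *)
Lemma lasso_scalar_kkt (R : realType) (q lam a c : R) : 0 <= q -> 0 <= lam ->
  (forall s, s * c <= q * s ^+ 2 + lam * (`|a + s| - `|a|)) ->
  `|c| <= lam /\ (a != 0 -> c = lam * Num.sg a).
Proof.
move=> q0 lam0 H; split.
  rewrite -subr_le0; apply: (@le0_of_quadratic _ q _ 1) => // t t0 _.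
  have := H (Num.sg c * t).
  have q1 : q * (Num.sg c * t) ^+ 2 <= q * t ^+ 2.
    by rewrite exprMn ler_wpM2l// ler_piMl ?sqr_ge0// sqr_sg; case: (c != 0).
  have l1 : lam * (`|a + Num.sg c * t| - `|a|) <= lam * t.
    rewrite ler_wpM2l// lerBlDr [leRHS]addrC; apply: (le_trans (ler_normD _ _)).
    rewrite lerD2l normrM normr_sg (gtr0_norm t0).
    by case: (c != 0); rewrite ?mul1r ?mul0r// ltW.
  have -> : t * (`|c| - lam) = Num.sg c * t * c - lam * t.
    by rewrite normrEsg; ring.
  lra.
move=> aN0; apply/eqP; rewrite -subr_eq0 -normr_le0.
have ap : 0 < `|a| by rewrite normr_gt0.
apply: (@le0_of_quadratic _ q _ `|a|) => // t t0 ta.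
set e := c - _; have := H (Num.sg e * t).
have sgt : `|Num.sg e * t| <= `|a|.
  rewrite normrM normr_sg (gtr0_norm t0).
  by case: (e != 0); rewrite ?mul1r ?mul0r// ltW.
have -> : `|a + Num.sg e * t| - `|a| = Num.sg a * (Num.sg e * t).
  move: sgt; case: (ltgtP a 0) aN0 => // a0 _.
    rewrite (ltr0_norm a0) (ltr0_sg a0) => /ler_normlP [s1 s2].
    rewrite ler0_norm; [ring|lra].
  rewrite (gtr0_norm a0) (gtr0_sg a0) => /ler_normlP [s1 s2].
  by rewrite ger0_norm; [ring|lra].
have q1 : q * (Num.sg e * t) ^+ 2 <= q * t ^+ 2.
  by rewrite exprMn ler_wpM2l// ler_piMl ?sqr_ge0// sqr_sg; case: (e != 0).
have -> : t * `|e| = Num.sg e * t * c - lam * (Num.sg a * (Num.sg e * t)).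
  by rewrite normrEsg {2}/e; ring.
lra.
Qed.

(** First-order conditions for the lasso: the residual correlations are at most
    [lam], with equality and the sign of [g] on the support of [g]. *)
Lemma lasso_kkt (R : realType) (n p : nat) (Z : 'M[R]_(n, p)) (Y : 'cV[R]_n)
    (lam : R) (g : 'cV[R]_p) (j : 'I_p) : 0 <= lam -> is_lasso Z Y lam g ->
  `|dotv (col j Z) (Y - Z *m g)| <= lam /\
  (g j 0 != 0 -> dotv (col j Z) (Y - Z *m g) = lam * Num.sg (g j 0)).
Proof.
move=> lam0 gmin; set r := Y - Z *m g.
apply: (@lasso_scalar_kkt _ (2^-1 * l2norm (col j Z) ^+ 2)) => //.
  by rewrite mulr_ge0 ?sqr_ge0// invr_ge0.
move=> s; have := gmin (g + s *: delta_mx j 0).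
have -> : Y - Z *m (g + s *: delta_mx j 0) = r - s *: col j Z.
  by rewrite mulmxDr -scalemxAr -colE opprD addrA.
have -> : l1norm (g + s *: delta_mx j 0) = l1norm g - `|g j 0| + `|g j 0 + s|.
  rewrite /l1norm (bigD1 j)//= [in RHS](bigD1 j)//= !mxE !eqxx mulr1.
  rewrite [X in _ + X = _](eq_bigr (fun i => `|g i 0|)); first by ring.
  by move=> i /negbTE ij; rewrite !mxE ij mulr0 addr0.
have E (x y : 'cV[R]_n) : l2norm (x - s *: y) ^+ 2 =
    l2norm x ^+ 2 - 2 * s * dotv y x + s ^+ 2 * l2norm y ^+ 2.
  rewrite !l2norm_sqr_dotv dotvBr !(dotvC (x - _)) !dotvBr !dotvZr.
  rewrite !(dotvC (s *: _)) !dotvZr (dotvC x y); ring.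
rewrite E -/r; lra.
Qed.

(** Under [lasso_dual_condition] there is a vector [nu], supported on the support
    of [g] and of the same signs there, such that [Z^T Z nu] is a subgradient of
    the l1 norm at [g].  This is a dual certificate for the optimality of [g] in
    the Dantzig selector problem. *)
Lemma lasso_dual_certificate (R : realType) (n p : nat) (Z : 'M[R]_(n, p))
    (g : 'cV[R]_p) : lasso_dual_condition Z g ->
  exists nu : 'cV[R]_p,
    [/\ forall j, nu j 0 * Num.sg (g j 0) = `|nu j 0|,
        forall j, g j 0 = 0 -> nu j 0 = 0,
        forall j, `|dotv (col j Z) (Z *m nu)| <= 1 &
        forall j, g j 0 != 0 -> dotv (col j Z) (Z *m nu) = Num.sg (g j 0)].
Proof.
rewrite /lasso_dual_condition; set D := sign_mx g.
set T := [set j | _]%SET; set ix := fun k : 'I_#|T| => enum_val k.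
set G := mxsub _ _ _; set u := invmx G *m _ => -[GU u0 Q1].
have colD j (w : 'cV[R]_n) : (Z^T *m w) j 0 = dotv (col j Z) w.
  by rewrite mxE; apply: eq_bigr => i _; rewrite !mxE.
(* [nu = D u], with [u] extended by zero outside the support of [g] *)
pose nu := colsub ix D *m u.
have nuE j : nu j 0 = Num.sg (g j 0) * \sum_k (j == ix k)%:R * u k 0.
  rewrite mxE mulr_sumr; apply: eq_bigr => k _.
  by rewrite mulrA; congr (_ * _); rewrite !mxE mulr_natr.
have y0 j : 0 <= \sum_k (j == ix k)%:R * u k 0.
  by apply: sumr_ge0 => k _; rewrite mulr_ge0.
have QE j : (Z^T *m Z *m colsub ix D *m u) j 0 = dotv (col j Z) (Z *m nu).
  by rewrite -colD -!mulmxA.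
exists nu; split.
- move=> j; rewrite nuE normrM (ger0_norm (y0 j)) normr_sg mulrAC -expr2 sqr_sg.
  by [].
- by move=> j gj; rewrite nuE gj sgr0 mul0r.
- by move=> j; rewrite -QE.
- move=> j gj; have jT : j \in T by rewrite finset.inE.
  have Gu : G *m u = const_mx 1 by rewrite mulmxA mulmxV// mul1mx.
  have GuE : G *m u = rowsub ix (D *m (Z^T *m Z *m colsub ix D *m u)).
    by rewrite /G mxsub_mul -mulmxA -/nu mul_rowsub_mx -!mulmxA.
  have : (G *m u) (enum_rank_in jT j) 0 = 1 by rewrite Gu mxE.
  rewrite GuE mxE mul_diag_mx mxE QE mxE /ix enum_rankK_in// => H.
  rewrite -[RHS]mulr1 -H mulrA -expr2 sqr_sg gj mul1r //.
Qed.

(** Complementary slackness: a lasso solution satisfying the dual condition is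
    a solution of the Dantzig selector problem with the same tuning parameter. *)
Lemma lasso_is_dantzig (R : realType) (n p : nat) (Z : 'M[R]_(n, p))
    (Y : 'cV[R]_n) (lam : R) (g : 'cV[R]_p) : 0 <= lam ->
  is_lasso Z Y lam g -> lasso_dual_condition Z g -> is_dantzig Z Y lam g.
Proof.
move=> lam0 gmin /lasso_dual_certificate[nu [nusg nu0 Q1 Qsg]].
have kkt j := lasso_kkt j lam0 gmin.
split; first by move=> j; case: (kkt j).
move=> h fh.
pose q j := dotv (col j Z) (Z *m nu).
(* [Z^T Z nu] evaluated at [v], rewritten with the residual of [v] *)
have qE (v : 'cV[R]_p) : \sum_j v j 0 * q j = dotv (Z *m nu) Y -
    \sum_j nu j 0 * dotv (col j Z) (Y - Z *m v).
  by rewrite /q -!dotv_mulmx -dotvBr opprB [Y + _]addrC subrK dotvC.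
have -> : l1norm g = \sum_j g j 0 * q j.
  apply: eq_bigr => j _; have [->|gj] := eqVneq (g j 0) 0; first by rewrite mul0r normr0.
  by rewrite /q Qsg// mulrC -normrEsg.
apply: (@le_trans _ _ (\sum_j h j 0 * q j)); last first.
  apply: ler_sum => j _; apply: (le_trans (ler_norm _)).
  by rewrite normrM ler_piMr// /q.
rewrite !qE lerD2l lerN2; apply: ler_sum => j _.
apply: (@le_trans _ _ (`|nu j 0| * lam)).
  apply: (le_trans (ler_norm _)); rewrite normrM ler_wpM2l//; exact: fh.
have [gj|gj] := eqVneq (g j 0) 0; first by rewrite (nu0 _ gj) normr0 !mul0r.
by have [_ /(_ gj) ->] := kkt j; rewrite mulrCA nusg mulrC.
Qed.

(** * The functional linear model *)

Lemma measurable_unit_itv (R : realType) :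
  measurable (`[(0 : R), 1]%classic : set (measurableTypeR R)).
Proof. exact: measurable_itv. Qed.

Lemma eq_int01 (R : realType) (f g : R -> R) : f =1 g -> int01 f = int01 g.
Proof. by move=> fg; congr int01; apply/funext. Qed.

Lemma integrable01Z (R : realType) (f : R -> R) (a : R) :
  integrable01 f -> integrable01 (fun t => f t * a).
Proof.
move=> If; have := integrableZr (@measurable_unit_itv R) a If.
by apply: eq_integrable => //; exact: measurable_unit_itv.
Qed.

Lemma integrable01B (R : realType) (f g : R -> R) :
  integrable01 f -> integrable01 g -> integrable01 (fun t => f t - g t).
Proof.
move=> If Ig; have := integrableB (@measurable_unit_itv R) If Ig.
by apply: eq_integrable => //; exact: measurable_unit_itv.
Qed.

Lemma integrable01_sum (R : realType) (k : nat) (F : 'I_k -> R -> R) (a : 'I_k -> R) :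
  (forall l, integrable01 (F l)) ->
  integrable01 (fun t => \sum_l F l t * a l) /\
  int01 (fun t => \sum_l F l t * a l) = \sum_l int01 (F l) * a l.
Proof.
move=> IF; elim: (index_enum _) => [|l r [Ir Er]].
  have E0 : (fun t : R => \sum_(l <- [::]) F l t * a l) = cst 0.
    by apply/funext => t; rewrite big_nil.
  rewrite E0 big_nil; split.
    by apply: integrable0; exact: measurable_unit_itv.
  by rewrite /int01 Rintegral_cst ?mul0r//; exact: measurable_unit_itv.
have E : (fun t : R => \sum_(l <- l :: r) F l t * a l) =
   (fun t => F l t * a l + \sum_(l <- r) F l t * a l).
  by apply/funext => t; rewrite big_cons.
have IZ := @integrable01Z _ (F l) (a l) (IF l).
rewrite E big_cons; split.
  have := integrableD (@measurable_unit_itv R) IZ Ir.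
  by apply: eq_integrable => //; exact: measurable_unit_itv.
rewrite -Er /int01 (RintegralD (@measurable_unit_itv R) IZ Ir); congr (_ + _).
exact: (RintegralZr _ (@measurable_unit_itv R) (IF l)).
Qed.

(** Hoelder's inequality between l1 and the supremum norm on the unit interval. *)
Lemma int01_le_bound (R : realType) (x f : R -> R) (M W : R) :
  integrable01 x -> integrable01 (fun t => x t * f t) ->
  int01 (fun t => `|x t|) <= M -> 0 <= W ->
  (forall t, t \in `[0, 1] -> `|f t| <= W) ->
  `|int01 (fun t => x t * f t)| <= M * W.
Proof.
move=> Ix Ixf xM W0 fW; have mI := @measurable_unit_itv R.
have Inx : integrable01 (fun t => `|x t|) by exact: (integrable_norm Ix).
have Inxf : integrable01 (fun t => `|x t * f t|) by exact: (integrable_norm Ixf).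
apply: (le_trans (le_normr_Rintegral mI Ixf)).
apply: (@le_trans _ _ (int01 (fun t => `|x t| * W))).
  apply: le_Rintegral => //; first exact: integrable01Z.
  by move=> t /= tI; rewrite normrM ler_wpM2l// fW// inE.
by rewrite /int01 RintegralZr// ler_wpM2r.
Qed.

Lemma design_mxE (R : realType) (X : nat -> R -> R) (p : nat)
    (B : R -> 'cV[R]_p) (A : 'M[R]_p) (n : nat) (i : 'I_n) (j : 'I_p) :
  (forall l : 'I_p, integrable01 (fun t => X i t * B t l 0)) ->
  integrable01 (fun s => X i s * dotv (B s) (col j (invmx A))) /\
  design_mx X B A n i j = int01 (fun s => X i s * dotv (B s) (col j (invmx A))).
Proof.
move=> IB; have [I1 E1] := integrable01_sum (fun l => invmx A l j) IB.
have E : (fun s => X i s * dotv (B s) (col j (invmx A))) =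
    (fun t => \sum_l X i t * B t l 0 * invmx A l j).
  by apply/funext => t; rewrite mulr_sumr; apply: eq_bigr => l _; rewrite mxE mulrA.
rewrite E; split => //; rewrite E1 mxE; apply: eq_bigr => l _; by rewrite mxE.
Qed.

Lemma design_mx_mul (R : realType) (X : nat -> R -> R) (p : nat)
    (B : R -> 'cV[R]_p) (A : 'M[R]_p) (eta : 'cV[R]_p) (n : nat) (i : 'I_n) :
  A \in unitmx -> (forall l : 'I_p, integrable01 (fun t => X i t * B t l 0)) ->
  integrable01 (fun s => X i s * dotv (B s) eta) /\
  (design_mx X B A n *m (A *m eta)) i 0 = int01 (fun s => X i s * dotv (B s) eta).
Proof.
move=> UA IB; have [I1 E1] := integrable01_sum (fun l => eta l 0) IB.
have E : (fun s => X i s * dotv (B s) eta) =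
    (fun t => \sum_l X i t * B t l 0 * eta l 0).
  by apply/funext => t; rewrite mulr_sumr; apply: eq_bigr => l _; rewrite mulrA.
rewrite E; split => //; rewrite E1 /design_mx mulmxA mulmxKV//.
by rewrite mxE; apply: eq_bigr => l _; rewrite mxE.
Qed.

Lemma col_design_norm (R : realType) (X : nat -> R -> R) (p : nat)
    (B : R -> 'cV[R]_p) (A : 'M[R]_p) (n : nat) (j : 'I_p) :
  (forall i (l : 'I_p), integrable01 (fun t => X i t * B t l 0)) ->
  \sum_(i < n) int01 (fun s => X i s * dotv (B s) (col j (invmx A))) ^+ 2 =
  l2norm (col j (design_mx X B A n)) ^+ 2.
Proof.
move=> IB; rewrite l2norm_sqr; apply: eq_bigr => i _.
by rewrite mxE; have [_ ->] := @design_mxE _ X p B A n i j (IB i).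
Qed.

Lemma std_cols_unit (R : realType) (n p : nat) (V : 'M[R]_(n, p)) (j : 'I_p) :
  col j V != 0 -> \sum_i std_cols V i j ^+ 2 = 1.
Proof.
rewrite -l2norm_eq0 => V0.
under eq_bigr do rewrite mxE exprMn.
rewrite -mulr_suml (_ : \sum_i V i j ^+ 2 = l2norm (col j V) ^+ 2).
  by rewrite -exprMn divff// expr1n.
by rewrite l2norm_sqr; apply: eq_bigr => i _; rewrite mxE.
Qed.

(** The coefficient vector on the scale of the standardized columns. *)
Definition gamma_std (R : realType) (n p : nat) (V : 'M[R]_(n, p)) (gam : 'cV[R]_p) :
  'cV[R]_p := \col_j (gam j 0 * l2norm (col j V)).

Lemma std_cols_gamma_std (R : realType) (n p : nat) (V : 'M[R]_(n, p))
    (gam : 'cV[R]_p) :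
  (forall j, col j V != 0) -> std_cols V *m gamma_std V gam = V *m gam.
Proof.
move=> V0; apply/colP => i; rewrite !mxE; apply: eq_bigr => j _.
by rewrite !mxE; field; rewrite l2norm_eq0.
Qed.

Lemma nb_nonzero_gamma_std (R : realType) (n p : nat) (V : 'M[R]_(n, p))
    (gam : 'cV[R]_p) : (nb_nonzero (gamma_std V gam) <= nb_nonzero gam)%N.
Proof.
apply: subset_leq_card; apply/fintype.subsetP => j.
by rewrite !finset.inE !mxE; apply: contra_neq => ->; rewrite mul0r.
Qed.

(** The error of the estimated function at [t], in terms of the error of the
    standardized coefficients: the Cauchy-Schwarz inequality, the squared weights
    adding up to [alpha_np t ^+ 2 / n]. *)
Lemma beta_hat_error (R : realType) (X : nat -> R -> R) (beta : R -> R) (p : nat)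
    (B : R -> 'cV[R]_p) (A : 'M[R]_p) (eta : 'cV[R]_p) (n : nat) (g : 'cV[R]_p)
    (V := design_mx X B A n) (t : R) :
  (0 < n)%N -> A \in unitmx -> (forall j, col j V != 0) ->
  (forall i (l : 'I_p), integrable01 (fun t => X i t * B t l 0)) ->
  `|beta_hat B A (gamma_hat V g) t - beta t| <=
  alpha_np X B A n t / Num.sqrt n%:R * l2norm (g - gamma_std V (A *m eta)) +
  `|approx_err beta B eta t|.
Proof.
move=> n0 UA V0 IB; set gam := A *m eta; set h := g - _.
have nR0 : 0 < n%:R :> R by rewrite ltr0n.
have Vn j : l2norm (col j V) != 0 by rewrite l2norm_eq0.
pose f j := dotv (B t) (col j (invmx A)).
have alphaE : alpha_np X B A n t / Num.sqrt n%:R =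
    Num.sqrt (\sum_j (f j / l2norm (col j V)) ^+ 2).
  rewrite /alpha_np -sqrtrV ?ler0n// -sqrtrM; last first.
    apply: sumr_ge0 => j _; rewrite divr_ge0 ?sqr_ge0// mulr_ge0 ?invr_ge0 ?ler0n//.
    by apply: sumr_ge0 => i _; exact: sqr_ge0.
  congr Num.sqrt; rewrite mulr_suml; apply: eq_bigr => j _.
  rewrite col_design_norm// -/V -/(f j); field.
  by rewrite Vn gt_eqF.
have -> : beta_hat B A (gamma_hat V g) t - beta t =
    \sum_j (f j / l2norm (col j V)) * h j 0 - approx_err beta B eta t.
  rewrite /approx_err opprB addrA; congr (_ - _).
  have etaE : eta = invmx A *m gam by rewrite /gam mulKmx.
  rewrite {1}etaE /beta_hat.
  have dE v : dotv (B t) (invmx A *m v) = \sum_j f j * v j 0.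
    by rewrite dotvC dotv_mulmx; apply: eq_bigr => j _; rewrite dotvC mulrC.
  rewrite !dE -big_split/=; apply: eq_bigr => j _; rewrite !mxE.
  by field; rewrite Vn.
apply: (le_trans (ler_normB _ _)); rewrite lerD2r alphaE.
rewrite -(@ler_pXn2r _ 2)// ?nnegrE ?mulr_ge0 ?sqrtr_ge0 ?l2norm_ge0//.
rewrite exprMn sqr_sqrtr ?l2norm_sqr ?real_normK ?num_real//.
  exact: (cauchy_schwarz_sum predT (fun j => f j / l2norm (col j V)) (fun j => h j 0)).
by apply: sumr_ge0 => j _; exact: sqr_ge0.
Qed.
Lemma sup01_le (R : realType) (f : R -> R) (C : \bar R) :
  (forall t, t \in `[0, 1] -> ((f t)%:E <= C)%E) -> (sup01 f <= C)%E.
Proof. by move=> fC; apply: ge_ereal_sup => _ [t tI <-]; apply: fC. Qed.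

Lemma le_sup01 (R : realType) (f : R -> R) (t : R) :
  t \in `[0, 1] -> ((f t)%:E <= sup01 f)%E.
Proof. by move=> tI; apply: ereal_sup_ubound; exists t. Qed.

Lemma omega_sup_fine (R : realType) (beta : R -> R) (p : nat)
    (B : R -> 'cV[R]_p) (eta : 'cV[R]_p) (C : R) :
  (omega_sup beta B eta <= C%:E)%E ->
  [/\ 0 <= fine (omega_sup beta B eta), fine (omega_sup beta B eta) <= C &
   forall t, t \in `[0, 1] ->
     `|approx_err beta B eta t| <= fine (omega_sup beta B eta)].
Proof.
move=> oC; set om := omega_sup _ _ _ in oC *.
have le t : t \in `[0, 1] -> (`|approx_err beta B eta t|%:E <= om)%E.
  exact: (@le_sup01 R (fun t => `|approx_err beta B eta t|)).
have om0 : (0 <= om)%E.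
  apply: (le_trans _ (le 0 _)); first by rewrite lee_fin.
  by rewrite in_itv/= lexx ler01.
have omfin : om \is a fin_num by rewrite ge0_fin_numE// (le_lt_trans oC)// ltry.
split; first exact: fine_ge0.
  by rewrite -lee_fin fineK.
by move=> t /le; rewrite -lee_fin fineK.
Qed.

(** On the event that the noise is uncorrelated enough with the standardized
    columns, the true coefficients are feasible: the second part of the tuning
    parameter absorbs the approximation error. *)
Lemma true_coef_feasible (R : realType) (Omega : Type) (X : nat -> R -> R)
    (beta : R -> R) (eps : nat -> Omega -> R) (p : nat) (B : R -> 'cV[R]_p)
    (A : 'M[R]_p) (eta : 'cV[R]_p) (n : nat) (w : Omega) (M W x : R)
    (V := design_mx X B A n) :
  A \in unitmx -> (forall j, col j V != 0) ->
  (forall i, integrable01 (X i)) ->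
  (forall i, integrable01 (fun t => X i t * beta t)) ->
  (forall i (l : 'I_p), integrable01 (fun t => X i t * B t l 0)) ->
  (forall i, int01 (fun t => `|X i t|) <= M) ->
  0 <= M -> 0 <= W ->
  (forall t, t \in `[0, 1] -> `|approx_err beta B eta t| <= W) ->
  (forall j, `|\sum_(i < n) std_cols V i j * eps i w| <= x) ->
  dantzig_feasible (std_cols V) (response X beta eps n w)
    (x + M * W * Num.sqrt n%:R) (gamma_std V (A *m eta)).
Proof.
move=> UA V0 IX Ibeta IB XM M0 W0 eW noise j; rewrite std_cols_gamma_std//.
pose a : 'cV[R]_n := \col_i int01 (fun t => X i t * approx_err beta B eta t).
have aE i : (response X beta eps n w - V *m (A *m eta)) i 0 = a i 0 + eps i w.
  have [I1 E1] := @design_mx_mul _ X p B A eta n i UA (IB i).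
  have subE (u v : 'cV[R]_n) : (u - v) i 0 = u i 0 - v i 0 by rewrite !mxE.
  rewrite subE E1 !mxE addrAC; congr (_ + _).
  rewrite /int01 -(RintegralB (@measurable_unit_itv R) (Ibeta i) I1).
  by apply: eq_int01 => t; rewrite mulrBr.
have a_le i : `|a i 0| <= M * W.
  rewrite mxE; apply: int01_le_bound => //.
  have [I1 _] := @design_mx_mul _ X p B A eta n i UA (IB i).
  rewrite (_ : (fun t => _) = (fun t => X i t * beta t - X i t * dotv (B t) eta)).
    exact: integrable01B.
  by apply/funext => t; rewrite mulrBr.
have -> : dotv (col j (std_cols V)) (response X beta eps n w - V *m (A *m eta)) =
    dotv (col j (std_cols V)) a + \sum_(i < n) std_cols V i j * eps i w.
  by rewrite -big_split/=; apply: eq_bigr => i _; rewrite aE [col _ _ _ _]mxE mulrDr.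
apply: (le_trans (ler_normD _ _)); rewrite [leLHS]addrC; apply: lerD => //.
apply: (le_trans (cauchy_schwarz _ _)).
have -> : l2norm (col j (std_cols V)) = 1.
  rewrite -(sqrtr1 R); congr Num.sqrt; rewrite -(std_cols_unit (V0 j)).
  by apply: eq_bigr => i _; rewrite mxE.
have rhs0 : 0 <= M * W * Num.sqrt n%:R by rewrite !mulr_ge0 ?sqrtr_ge0.
rewrite mul1r -(@ler_pXn2r _ 2)// ?nnegrE ?l2norm_ge0//.
rewrite exprMn (sqr_sqrtr (ler0n _ n)) l2norm_sqr mulr_natr.
rewrite -[X in _ *+ X](card_ord n) -sumr_const; apply: ler_sum => i _.
by rewrite -(real_normK (num_real (a i 0))) lerXn2r ?nnegrE ?mulr_ge0.
Qed.

Lemma alpha_np_ge0 (R : realType) (X : nat -> R -> R) (p : nat)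
    (B : R -> 'cV[R]_p) (A : 'M[R]_p) (n : nat) (t : R) : 0 <= alpha_np X B A n t.
Proof. exact: sqrtr_ge0. Qed.

(** The deterministic part of the argument: on the event that no column of the
    standardized design has a noise correlation above [x], a Dantzig selector
    solution gives a pointwise error bound for the estimated function. *)
Lemma flirti_error (R : realType) (Omega : Type) (X : nat -> R -> R)
    (beta : R -> R) (eps : nat -> Omega -> R) (p : nat) (B : R -> 'cV[R]_p)
    (A : 'M[R]_p) (eta : 'cV[R]_p) (n S : nat) (w : Omega) (M W x kappa : R)
    (g : 'cV[R]_p) (V := design_mx X B A n) (lam := x + M * W * Num.sqrt n%:R) :
  (0 < n)%N -> A \in unitmx -> (forall j, col j V != 0) ->
  (forall i, integrable01 (X i)) ->
  (forall i, integrable01 (fun t => X i t * beta t)) ->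
  (forall i (l : 'I_p), integrable01 (fun t => X i t * B t l 0)) ->
  (forall i, int01 (fun t => `|X i t|) <= M) ->
  0 <= M -> 0 <= W -> 0 <= x -> 0 < kappa ->
  (forall t, t \in `[0, 1] -> `|approx_err beta B eta t| <= W) ->
  (nb_nonzero (A *m eta) <= S)%N ->
  delta_rip (2 * S) V + theta_rip S (2 * S) V <= 1 - kappa ->
  (forall j, `|\sum_(i < n) std_cols V i j * eps i w| <= x) ->
  is_dantzig (std_cols V) (response X beta eps n w) lam g ->
  forall t, t \in `[0, 1] ->
  `|beta_hat B A (gamma_hat V g) t - beta t| <=
  alpha_np X B A n t / Num.sqrt n%:R * (4 * Num.sqrt S%:R * lam / kappa) + W.
Proof.
move=> n0 UA V0 IX Ibeta IB XM M0 W0 x0 k0 eW sparse rip noise dz t tI.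
have lam0 : 0 <= lam by rewrite addr_ge0// !mulr_ge0// sqrtr_ge0.
apply: (le_trans (@beta_hat_error _ X beta p B A eta n g t n0 UA V0 IB)).
apply: lerD; last exact: eW.
apply: ler_wpM2l; first by rewrite divr_ge0 ?sqrtr_ge0.
rewrite ler_pdivlMr//.
have feas := @true_coef_feasible _ Omega X beta eps p B A eta n w M W x
  UA V0 IX Ibeta IB XM M0 W0 eW noise.
have rip1 : delta_rip (2 * S) V + theta_rip S (2 * S) V < 1.
  by apply: (le_lt_trans rip); rewrite gtrBl.
have sp := leq_trans (nb_nonzero_gamma_std V (A *m eta)) sparse.
apply: le_trans (dantzig_l2_error lam0 sp rip1 feas dz).
by rewrite mulrC ler_wpM2r ?l2norm_ge0// lerBrDr -lerBrDl.
Qed.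

(** A lower bound on any upper bound [s] of [alpha_np].  Each coefficient function
    is at most [s] times the root mean square of its scores, while the scores are
    at most [M] times the supremum of that function.  As [M] is fixed, a bound
    [C * p `^ c] on the supremum for all [p] forces [0 <= c]. *)
Lemma sup_alpha_lower (R : realType) (X : nat -> R -> R) (p : nat)
    (B : R -> 'cV[R]_p) (A : 'M[R]_p) (n : nat) (M s : R) :
  (0 < n)%N -> (0 < p)%N -> (forall j, col j (design_mx X B A n) != 0) ->
  (forall i, integrable01 (X i)) ->
  (forall i (l : 'I_p), integrable01 (fun t => X i t * B t l 0)) ->
  (forall i, int01 (fun t => `|X i t|) <= M) -> 0 <= M -> 0 <= s ->
  (forall t, t \in `[0, 1] -> alpha_np X B A n t <= s) -> 1 <= M * s.
Proof.
move=> n0 p0 V0 IX IB XM M0 s0 als; have nR0 : 0 < n%:R :> R by rewrite ltr0n.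
pose j : 'I_p := Ordinal p0.
pose f t := dotv (B t) (col j (invmx A)).
pose den k := n%:R^-1 * \sum_(i < n)
  int01 (fun s => X i s * dotv (B s) (col k (invmx A))) ^+ 2.
have den_ge0 k : 0 <= den k.
  rewrite mulr_ge0 ?invr_ge0 ?ler0n//.
  by apply: sumr_ge0 => i _; exact: sqr_ge0.
have den0 : 0 < den j.
  rewrite mulr_gt0 ?invr_gt0// col_design_norm// exprn_even_gt0//=.
  by rewrite l2norm_eq0.
have fle t : t \in `[0, 1] -> `|f t| <= s * Num.sqrt (den j).
  move=> tI; rewrite -(@ler_pXn2r _ 2)// ?nnegrE ?mulr_ge0 ?sqrtr_ge0//.
  rewrite exprMn sqr_sqrtr// real_normK ?num_real// -ler_pdivrMr//.
  apply: (@le_trans _ _ (alpha_np X B A n t ^+ 2)); last first.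
    by rewrite lerXn2r ?nnegrE ?sqrtr_ge0// als.
  rewrite /alpha_np sqr_sqrtr; last first.
    by apply: sumr_ge0 => k _; rewrite divr_ge0 ?sqr_ge0//; exact: den_ge0.
  rewrite (bigD1 j)//= -/(den j) -/(f t) lerDl.
  by apply: sumr_ge0 => k _; rewrite divr_ge0 ?sqr_ge0//; exact: den_ge0.
have int_le (i : 'I_n) : int01 (fun t => X i t * f t) ^+ 2 <= (M * s) ^+ 2 * den j.
  rewrite -(real_normK (num_real _)) -[X in _ * X](sqr_sqrtr (den_ge0 j)) -exprMn.
  rewrite lerXn2r ?nnegrE ?mulr_ge0 ?sqrtr_ge0// -mulrA.
  apply: int01_le_bound => //; last by rewrite mulr_ge0 ?sqrtr_ge0.
  by have [I1 _] := @design_mxE _ X p B A n i j (IB i).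
have : den j <= (M * s) ^+ 2 * den j.
  rewrite {1}/den ler_pdivrMl//.
  apply: (@le_trans _ _ (\sum_(i < n) (M * s) ^+ 2 * den j)).
    by apply: ler_sum => i _; exact: int_le.
  by rewrite sumr_const card_ord mulr_natl.
rewrite -[X in X <= _]mul1r (ler_pM2r den0) => h.
by rewrite -(@ler_pXn2r _ 2)// ?nnegrE ?mulr_ge0// expr1n.
Qed.
(** * Convergence in probability and rates *)

(** A sufficient condition for [with_prob_to_one]: for large [n] the set [Q n]
    contains an event whose complement has probability at most [r n], where [r]
    tends to zero.  No relation between these events for different [n] is
    needed. *)
Lemma with_prob_to_oneI (R : realType) (d : measure_display)
    (Omega : measurableType d) (P : probability Omega R)
    (Q : nat -> set Omega) (r : nat -> R) :
  r n @[n --> \oo] --> 0 ->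
  (\forall n \near \oo, exists E : set Omega,
     [/\ measurable E, E `<=` Q n & (P (~` E) <= (r n)%:E)%E]) ->
  with_prob_to_one P Q.
Proof.
move=> r0 HQ.
have /choice[E EP] : forall n, exists E : set Omega,
    [/\ measurable E, E `<=` Q n &
      (exists E', [/\ measurable E', E' `<=` Q n & (P (~` E') <= (r n)%:E)%E]) ->
      (P (~` E) <= (r n)%:E)%E].
  move=> n.
  have [[E' [mE' EQ PE]]|no] := pselect (exists E' : set Omega,
      [/\ measurable E', E' `<=` Q n & (P (~` E') <= (r n)%:E)%E]).
    by exists E'.
  by exists set0; split.
exists E; split; [by move=> n; case: (EP n)|by move=> n; case: (EP n)|].
apply: (@squeeze_cvge _ _ _ _ (fun n => (1 - r n)%:E) (fun n => P (E n)) (cst 1%E)).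
- near=> n; rewrite probability_le1 ?andbT; last by case: (EP n).
  have [mE _ PE] := EP n.
  have {}PE : (P (~` E n) <= (r n)%:E)%E by apply: PE; near: n.
  rewrite EFinB leeBlDr// -(@probability_setT _ _ _ P) -(setvU (E n)).
  rewrite measureU//; [by rewrite addeC leeD2l|exact: measurableC|exact: setICl].
- apply: cvg_EFin; first by near=> n.
  rewrite -[X in _ --> X]subr0; apply: cvgB; [exact: cvg_cst|exact: r0].
- exact: cvg_cst.
Unshelve. all: by end_near. Qed.

(** The union bound over [p] columns at the noise level of the tuning parameter.
    The factor [p] is cancelled by the exponential, and [x^-1] is what remains. *)
Lemma noise_level_bound (R : realType) (p : nat) (phi : R) :
  (1 < p)%N -> 0 <= phi ->
  let x := Num.sqrt (2 * (1 + phi) * ln p%:R) in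
  0 < x /\
  p%:R * (2 * (normal_peak 1 * expR (- (x ^+ 2) / 2) / x)) <=
    2 * normal_peak 1 / Num.sqrt (ln (p%:R : R)).
Proof.
move=> p1 phi0 x; have p0 : 0 < p%:R :> R by rewrite ltr0n (ltn_trans _ p1).
have lnp : 0 < ln p%:R :> R by rewrite ln_gt0// ltr1n.
have s0 : 0 < Num.sqrt (ln p%:R) :> R by rewrite sqrtr_gt0.
have a0 : 0 <= 2 * (1 + phi) * ln p%:R by rewrite !mulr_ge0// ?addr_ge0// ltW.
have xs : Num.sqrt (ln p%:R) <= x by rewrite ler_sqrt// ler_peMl ?ltW//; lra.
have x0 : 0 < x by exact: lt_le_trans xs.
split => //.
have e1 : p%:R * expR (- (x ^+ 2) / 2) <= 1.
  have pE : p%:R^-1 = expR (- ln p%:R) :> R by rewrite expRN lnK ?posrE.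
  rewrite sqr_sqrtr// -ler_pdivlMl// mulr1 pE ler_expR.
  by have := mulr_ge0 phi0 (ltW lnp); lra.
have k0 : 0 <= normal_peak 1 :> R by exact: normal_peak_ge0.
have -> : p%:R * (2 * (normal_peak 1 * expR (- (x ^+ 2) / 2) / x)) =
   (2 * normal_peak 1) * (p%:R * expR (- (x ^+ 2) / 2)) / x by ring.
apply: ler_pM.
- by rewrite !mulr_ge0 ?expR_ge0// ltW.
- by rewrite invr_ge0 ltW.
- by rewrite ler_piMr// mulr_ge0.
- by rewrite lef_pV2 ?posrE.
Qed.

Lemma noise_level_cvg (R : realType) (p : nat -> nat) :
  p n @[n --> \oo] --> \oo ->
  2 * normal_peak 1 / Num.sqrt (ln ((p n)%:R : R)) @[n --> \oo] --> (0 : R).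
Proof.
move=> poo.
have pR : ((p n)%:R : R) @[n --> \oo] --> +oo by exact/cvgrnyP.
have sln : Num.sqrt (ln ((p n)%:R : R)) @[n --> \oo] --> +oo.
  apply/cvgryPge => A; near=> n.
  have pn : expR (A ^+ 2) <= (p n)%:R by near: n; move/cvgryPge : pR; exact.
  apply: (le_trans (ler_norm A)); rewrite -sqrtr_sqr ler_wsqrtr//.
  rewrite -[leLHS]expRK ler_ln ?posrE ?expR_gt0//.
  by apply: lt_le_trans pn; exact: expR_gt0.
rewrite -(mulr0 (2 * normal_peak 1)); apply: cvgM; first exact: cvg_cst.
apply/gtr0_cvgV0 => //.
by near=> n; apply: lt_le_trans (_ : 1 <= _) => //; near: n; move/cvgryPge : sln; exact.
Unshelve. all: by end_near. Qed.

(** For [p] of order [n `^ (2 * m)^-1] the estimation error and the approximation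
    error are both at most a constant, free of [n] and [p], times the rate: as
    [p `^ (- m)] is of order [n `^ (- 2^-1)], the approximation error is at most of
    that order, and [tuning] at most of order [sqrt (ln n)]. *)
Lemma rate_bound (R : realType) (m b k K H Ca sigma phi M kappa alp om : R)
    (S n p : nat) :
  0 < m -> 0 <= b -> 0 < k -> 0 <= H -> 0 <= Ca -> 0 <= sigma -> 0 <= phi ->
  0 <= M -> 0 < kappa -> 0 <= om ->
  k <= p%:R / n%:R `^ (2 * m)^-1 <= K -> 1 <= ln (n%:R : R) -> (0 < n)%N -> (0 < p)%N ->
  om <= H / p%:R `^ m -> 0 <= alp -> alp <= Ca * p%:R `^ b ->
  alp / Num.sqrt n%:R * (4 * Num.sqrt S%:R * tuning sigma phi M om n p / kappa) + om <=
  (Ca * K `^ b * (4 * Num.sqrt S%:R *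
     (sigma * Num.sqrt (2 * (1 + phi) * (`|ln K| + (2 * m)^-1)) + M * (H / k `^ m)) / kappa)
   + H / k `^ m) * (Num.sqrt (ln n%:R) / n%:R `^ (2^-1 - b / (2 * m))).
Proof.
move=> m0 b0 k0 H0 Ca0 sig0 phi0 M0 kap0 om0 /andP[kp pK] lnN n0 p0 omH alp0 alpC.
set N : R := n%:R; have N0 : 0 < N by rewrite /N ltr0n.
have P0 : 0 < p%:R :> R by rewrite ltr0n.
set e := (2 * m)^-1; have e0 : 0 < e by rewrite invr_gt0 mulr_gt0.
have Ne0 : 0 < N `^ e by rewrite powR_gt0.
have K0 : 0 < K by apply: lt_le_trans pK; rewrite divr_gt0.
move: kp pK; rewrite ler_pdivlMr// ler_pdivrMr// => kp pK.
have kN0 : 0 < k * N `^ e by rewrite mulr_gt0.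
have KN0 : 0 < K * N `^ e by rewrite mulr_gt0.
set s := Num.sqrt N; have s0 : 0 < s by rewrite sqrtr_gt0.
set sl := Num.sqrt (ln N).
have sl1 : 1 <= sl by rewrite -(sqrtr1 R) ler_sqrt// (le_trans _ lnN).
set H' := H / k `^ m.
have km0 : 0 < k `^ m by rewrite powR_gt0.
have H'0 : 0 <= H' by rewrite divr_ge0// ltW.
have omle : om <= H' / s.
  apply: (le_trans omH); rewrite /H' -mulrA ler_wpM2l// -invfM.
  rewrite lef_pV2 ?posrE ?mulr_gt0 ?powR_gt0//.
  have -> : k `^ m * s = (k * N `^ e) `^ m.
    rewrite powRM ?ltW// -powRrM; congr (_ * _).
    by rewrite /s -powR12_sqrt ?ltW//; congr (_ `^ _); rewrite /e; field; exact: lt0r_neq0.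
  by apply: ge0_ler_powR; rewrite ?nnegrE// ?ltW.
set L := `|ln K| + e.
have L0 : 0 <= L by rewrite addr_ge0// ltW.
(* the assumption [1 <= ln N] absorbs the constant [ln K] *)
have lnp : ln (p%:R : R) <= L * ln N.
  apply: (@le_trans _ _ (ln (K * N `^ e))).
    by rewrite ler_ln ?posrE ?mulr_gt0.
  rewrite lnM ?posrE// ln_powR mulrDl lerD2r; apply: (le_trans (ler_norm _)).
  by rewrite ler_peMr.
set C1 := sigma * _ + _.
have lamle : tuning sigma phi M om n p <= C1 * sl.
  rewrite /tuning -/s /C1 [leRHS]mulrDl; apply: lerD.
    rewrite -[leRHS]mulrA ler_wpM2l// -sqrtrM; last by rewrite !mulr_ge0// addr_ge0.
    rewrite ler_sqrt; last by rewrite !mulr_ge0// ?addr_ge0// (le_trans _ lnN).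
    by rewrite -[leRHS]mulrA ler_wpM2l// mulr_ge0// addr_ge0.
  apply: (@le_trans _ _ (M * H')).
    by rewrite -mulrA ler_wpM2l// -ler_pdivlMr.
  by rewrite ler_peMr// mulr_ge0.
have C10 : 0 <= C1 by rewrite addr_ge0// mulr_ge0// sqrtr_ge0.
set nb := N `^ (b * e).
have rateE : sl / N `^ (2^-1 - b / (2 * m)) = sl * nb / s.
  rewrite -mulrA; congr (_ * _); rewrite powRB; last first.
    by apply/implyP => _; rewrite gt_eqF.
  by rewrite powR12_sqrt ?ltW// invf_div.
have nb1 : 1 <= nb.
  rewrite -(powRr0 N) ler_powR//; last by rewrite mulr_ge0// ltW.
  by rewrite /N ler1n.
have pble : p%:R `^ b <= K `^ b * nb.
  apply: (@le_trans _ _ ((K * N `^ e) `^ b)).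
    by apply: ge0_ler_powR; rewrite ?nnegrE// ?ltW.
  by rewrite powRM ?(ltW K0) ?(ltW Ne0)// -powRrM (mulrC e).
rewrite rateE [leRHS]mulrDl; apply: lerD; last first.
  apply: (le_trans omle); rewrite mulrA ler_wpM2r ?invr_ge0 ?(ltW s0)//.
  by rewrite ler_peMr// (le_trans sl1)// ler_peMr// (le_trans _ sl1).
have q0 : 0 <= 4 * Num.sqrt S%:R / kappa :> R.
  by rewrite divr_ge0 ?(ltW kap0)// mulr_ge0// sqrtr_ge0.
have tun0 : 0 <= tuning sigma phi M om n p.
  by rewrite addr_ge0// !mulr_ge0// sqrtr_ge0.
have -> : Ca * K `^ b * (4 * Num.sqrt S%:R * C1 / kappa) * (sl * nb / s) =
  (Ca * (K `^ b * nb)) / s * (4 * Num.sqrt S%:R / kappa * (C1 * sl)) by ring.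
have -> : 4 * Num.sqrt S%:R * tuning sigma phi M om n p / kappa =
  4 * Num.sqrt S%:R / kappa * tuning sigma phi M om n p by ring.
apply: ler_pM.
- by rewrite divr_ge0// ltW.
- by rewrite mulr_ge0.
- rewrite ler_wpM2r ?invr_ge0 ?(ltW s0)//; apply: (le_trans alpC).
  by rewrite ler_wpM2l.
- by rewrite ler_wpM2l.
Qed.

(** * The rate of convergence of the estimator *)

Theorem theorem4 (R : realType)
  (* the model *)
  (X : nat -> R -> R) (beta : R -> R)
  (d : measure_display) (Omega : measurableType d) (P : probability Omega R)
  (eps : nat -> {RV P >-> R}) (sigma1 M : R)
  (* bases and coefficients, for every dimension *)
  (B : forall p : nat, R -> 'cV[R]_p) (A : forall p : nat, 'M[R]_p)
  (eta : forall p : nat, 'cV[R]_p) (Sp : nat -> nat)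
  (* constants, dimension sequence, and standardized-scale estimates *)
  (S : nat) (m H t0 b c phi : R) (p : nat -> nat)
  (ghat : forall n : nat, Omega -> 'cV[R]_(p n))
  (V := fun n k => design_mx X (B k) (A k) n)
  (omega := fun k => omega_sup beta (B k) (eta k))
  (lambda := fun n => tuning sigma1 phi M (fine (omega (p n))) n (p n))
  (Y := response X beta eps)
  (bhat := fun n w => beta_hat (B (p n)) (A (p n))
                        (gamma_hat (V n (p n)) (ghat n w))) :
  (* errors *)
  0 < sigma1 ->
  mutually_independent eps ->
  (forall i, is_normal (eps i) 0 sigma1) ->
  (* predictors and existence of the integrals *)
  (forall i, integrable01 (X i)) ->
  (forall i, int01 (fun t => `|X i t|) <= M) ->
  (forall i, integrable01 (fun t => X i t * beta t)) ->
  (forall i k (j : 'I_k), integrable01 (fun t => X i t * B k t j 0)) ->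
  (* bases, transformations, sparsity, non-zero columns *)
  (forall k, basis01 (B k)) ->
  (forall k, A k \in unitmx) ->
  (forall k, (nb_nonzero (A k *m eta k) <= Sp k)%N) ->
  (forall n, (0 < n)%N -> forall j, col j (V n (p n)) != 0) ->
  (* (A-1) *)
  (forall k, (Sp k <= S)%N) ->
  (* (A-2) *)
  0 < m ->
  (forall k, (0 < k)%N -> (omega k <= (H / k%:R `^ m)%:E)%E) ->
  (* (A-3) *)
  t0 \in `[0, 1] ->
  0 <= b ->
  (exists C : R, forall n k, (0 < n)%N -> (0 < k)%N ->
     k%:R `^ (- b) * alpha_np X (B k) (A k) n t0 <= C) ->
  (* (A-4) *)
  (exists C : R, forall n k, (0 < n)%N -> (0 < k)%N ->
     ((k%:R `^ (- c))%:E * sup01 (alpha_np X (B k) (A k) n) <= C%:E)%E) ->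
  (* (A-6) *)
  p n @[n --> \oo] --> \oo ->
  ((p n)%:R / n%:R : R) @[n --> \oo] --> (0 : R) ->
  (exists kappa : R, 0 < kappa /\
     \forall n \near \oo,
       delta_rip (2 * S) (V n (p n)) + theta_rip S (2 * S) (V n (p n))
         <= 1 - kappa) ->
  (* the estimator and its conditions *)
  0 <= phi ->
  (\forall n \near \oo,
     delta_rip (2 * Sp (p n)) (V n (p n)) +
     theta_rip (Sp (p n)) (2 * Sp (p n)) (V n (p n)) < 1) ->
  (forall n w, is_dantzig (std_cols (V n (p n))) (Y n w) (lambda n) (ghat n w))
  \/
  ((forall n w, is_lasso (std_cols (V n (p n))) (Y n w) (lambda n) (ghat n w))
   /\ \forall n \near \oo,
        {ae P, forall w,
           lasso_dual_condition (std_cols (V n (p n))) (ghat n w)}) ->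
  (* exponents and growth of p *)
  b < m -> c < m ->
  grows_at_rate p (fun n => n%:R `^ (2 * m)^-1) ->
  (exists K : R, with_prob_to_one P (fun n =>
     [set w | `|bhat n w t0 - beta t0|
        <= K * (Num.sqrt (ln n%:R) / n%:R `^ (2^-1 - b / (2 * m)))]))
  /\
  (exists K : R, with_prob_to_one P (fun n =>
     [set w | (sup01 (fun t => `|bhat n w t - beta t|%R)
        <= (K * (Num.sqrt (ln n%:R) / n%:R `^ (2^-1 - c / (2 * m))))%R%:E)%E])).
Proof.
move=> s0 indep Neps IX XM IXb IXB _ UA sp V0 SpS m0 omH t0I b0 [C3 hC3] [C4 hC4].
move=> poo _ [kappa [kap0 rip]] phi0 _ est _ _ [k [K [k0 grow]]].
have M0 : 0 <= M by apply: le_trans (XM 0%N); apply: Rintegral_ge0.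
have p_gt0 n : (0 < n)%N -> (0 < p n)%N.
  move=> n0; have /andP[+ _] := grow n n0; case: (p n) => // /(lt_le_trans k0).
  by rewrite mul0r ltxx.
pose omP q (q0 : (0 < q)%N) := omega_sup_fine (omH q q0).
have H0 : 0 <= H.
  have [w_ge0 w_le _] := omP 1%N isT.
  by move: (le_trans w_ge0 w_le); rewrite powR1 divr1.
have om_ge0 n : (0 < n)%N -> 0 <= fine (omega (p n)).
  by move=> n0; have [] := omP _ (p_gt0 n n0).
pose al n t := alpha_np X (B (p n)) (A (p n)) n t.
have al_pow n t (e C : R) : (0 < n)%N -> (p n)%:R `^ (- e) * al n t <= C ->
    al n t <= C * (p n)%:R `^ e.
  move=> n0; have pn : 0 < (p n)%:R `^ e :> R by rewrite powR_gt0// ltr0n p_gt0.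
  by rewrite powRN mulrC ler_pdivrMr.
have al3 n : (0 < n)%N -> al n t0 <= C3 * (p n)%:R `^ b.
  by move=> n0; apply: al_pow => //; apply: hC3 => //; exact: p_gt0.
have al4 n t : (0 < n)%N -> t \in `[0, 1] -> al n t <= C4 * (p n)%:R `^ c.
  move=> n0 tI; apply: al_pow => //; rewrite -lee_fin EFinM.
  apply: le_trans (hC4 n (p n) n0 (p_gt0 n n0)).
  by apply: lee_wpmul2l; [rewrite lee_fin powR_ge0|exact: le_sup01].
have C_ge0 n t (e C : R) : (0 < n)%N -> al n t <= C * (p n)%:R `^ e -> 0 <= C.
  move=> n0 alC; have pn : 0 < (p n)%:R `^ e :> R by rewrite powR_gt0// ltr0n p_gt0.
  by rewrite -(pmulr_lge0 _ pn); apply: le_trans alC; exact: alpha_np_ge0.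
have C30 : 0 <= C3 by apply: (C_ge0 1%N t0 b) => //; exact: al3.
have C40 : 0 <= C4 by apply: (C_ge0 1%N t0 c) => //; exact: al4.
have pR : ((p n)%:R : R) @[n --> \oo] --> +oo by exact/cvgrnyP.
have c0 : 0 <= c.
  (* otherwise [sup_alpha_lower] bounds [p `^ (- c)], which is unbounded *)
  rewrite leNgt; apply/negP => c_lt0; have nc0 : 0 < - c by rewrite oppr_gt0.
  have : \forall n \near \oo, False.
    near=> n; have n0 : (0 < n)%N by near: n; exact: nbhs_infty_gt.
    have pn0 : 0 < (p n)%:R :> R by rewrite ltr0n p_gt0.
    have pn : (M * C4 + 1) `^ (- c)^-1 <= (p n)%:R.
      by near: n; move/cvgryPge : pR; exact.
    have one := @sup_alpha_lower R X (p n) (B (p n)) (A (p n)) n M (C4 * (p n)%:R `^ c)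
      n0 (p_gt0 n n0) (V0 n n0) IX (fun i l => IXB i (p n) l) XM M0
      (mulr_ge0 C40 (powR_ge0 _ _)) (fun t => al4 n t n0).
    have : M * C4 + 1 <= (p n)%:R `^ (- c).
      have -> : M * C4 + 1 = ((M * C4 + 1) `^ (- c)^-1) `^ (- c).
        by rewrite -powRrM mulVf ?gt_eqF// powRr1// addr_ge0// mulr_ge0.
      by apply: ge0_ler_powR; rewrite ?nnegrE ?powR_ge0 ?ler0n// ltW.
    move: one; rewrite powRN mulrA -ler_pdivrMr ?powR_gt0// div1r => h1 h2.
    by have := le_trans h2 h1; rewrite gerDl ler10.
  by case=> N _ /(_ N (leqnn N)).
(* for large [n] the estimate is almost surely a Dantzig selector solution *)
have dz : \forall n \near \oo, exists N : set Omega, [/\ measurable N, P N = 0%E &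
    forall w, ~ N w -> is_dantzig (std_cols (V n (p n))) (Y n w) (lambda n) (ghat n w)].
  case: est => [ed|[el ed]].
    by near=> n; exists set0; split.
  near=> n; have n0 : (0 < n)%N by near: n; exact: nbhs_infty_gt.
  have [N [mN PN NP]] : {ae P, forall w,
      lasso_dual_condition (std_cols (V n (p n))) (ghat n w)} by near: n.
  exists N; split => // w Nw; apply: lasso_is_dantzig => //.
    rewrite /lambda /tuning addr_ge0// !mulr_ge0 ?sqrtr_ge0 ?(ltW s0)//.
    exact: om_ge0.
  by apply: contrapT => ndual; apply: Nw; apply: NP.
(* the event [D n] contains a measurable one of probability tending to one *)
pose D n := [set w | forall t, t \in `[0, 1] -> `|bhat n w t - beta t| <=
  al n t / Num.sqrt n%:R * (4 * Num.sqrt S%:R * lambda n / kappa) + fine (omega (p n))].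
pose r n : R := 2 * normal_peak 1 / Num.sqrt (ln ((p n)%:R : R)).
have good : \forall n \near \oo, exists E : set Omega,
    [/\ measurable E, E `<=` D n & (P (~` E) <= (r n)%:E)%E].
  near=> n; have n0 : (0 < n)%N by near: n; exact: nbhs_infty_gt.
  have p1 : (1 < p n)%N by near: n; move/cvgnyPgt : poo; exact.
  have [N [mN PN Ndz]] : exists N : set Omega, [/\ measurable N, P N = 0%E &
    forall w, ~ N w -> is_dantzig (std_cols (V n (p n))) (Y n w) (lambda n) (ghat n w)].
    by near: n.
  have ripn : delta_rip (2 * S) (V n (p n)) + theta_rip S (2 * S) (V n (p n)) <= 1 - kappa.
    by near: n.
  have [x0 xr] := noise_level_bound p1 phi0.
  set x := Num.sqrt _ in x0 xr.
  have [mG PG] := gaussian_max_bound s0 indep Neps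
    (fun j => std_cols_unit (V0 n n0 j)) x0.
  set G := [set w | _] in mG PG.
  exists (G `\` N); split; first exact: measurableD.
    move=> w [Gw Nw] t tI; have [w_ge0 _ err_le] := omP _ (p_gt0 n n0).
    apply: (@flirti_error R Omega X beta eps (p n) (B (p n)) (A (p n)) (eta (p n))
      n S w M (fine (omega (p n))) (sigma1 * x) kappa) => //.
    - exact: V0.
    - by rewrite mulr_ge0// ltW.
    - exact: leq_trans (sp _) (SpS _).
    - exact: Ndz.
  rewrite setCD; apply: (@le_trans _ _ (P (~` G) + P N)%E).
    by apply: measureU2 => //; exact: measurableC.
  by rewrite PN adde0; apply: (le_trans PG); rewrite lee_fin.
have r0 : r n @[n --> \oo] --> 0 by exact: noise_level_cvg.
have lnn : \forall n \near \oo, (0 < n)%N /\ 1 <= ln (n%:R : R).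
  near=> n; have n0 : (0 < n)%N by near: n; exact: nbhs_infty_gt.
  split => //; rewrite -[leLHS]expRK ler_ln ?posrE ?expR_gt0 ?ltr0n//.
  by near: n; exact: nbhs_infty_ger.
pose rate := fun n t (e C : R) (n0 : (0 < n)%N) (ln1 : 1 <= ln (n%:R : R)) (e0 : 0 <= e)
    (C0 : 0 <= C) (alC : al n t <= C * (p n)%:R `^ e) =>
  @rate_bound R m e k K H C sigma1 phi M kappa (al n t)
    (fine (omega (p n))) S n (p n) m0 e0 k0 H0 C0 (ltW s0) phi0 M0 kap0 (om_ge0 n n0)
    (grow n n0) ln1 n0 (p_gt0 n n0) (let: And3 _ h _ := omP _ (p_gt0 n n0) in h)
    (alpha_np_ge0 _ _ _ _ _) alC.
split.
  eexists; apply: (with_prob_to_oneI r0); near=> n.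
  have [n0 ln1] : (0 < n)%N /\ 1 <= ln (n%:R : R) by near: n.
  have [E [mE ED PE]] : exists E : set Omega,
    [/\ measurable E, E `<=` D n & (P (~` E) <= (r n)%:E)%E] by near: n.
  exists E; split => // w /ED Dw; apply: (le_trans (Dw t0 t0I)).
  exact: (rate n t0 b C3 n0 ln1 b0 C30 (al3 n n0)).
eexists; apply: (with_prob_to_oneI r0); near=> n.
have [n0 ln1] : (0 < n)%N /\ 1 <= ln (n%:R : R) by near: n.
have [E [mE ED PE]] : exists E : set Omega,
  [/\ measurable E, E `<=` D n & (P (~` E) <= (r n)%:E)%E] by near: n.
exists E; split => // w /ED Dw; apply: sup01_le => t tI; rewrite lee_fin.
apply: (le_trans (Dw t tI)).
exact: (rate n t c C4 n0 ln1 c0 C40 (al4 n t n0 tI)).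
Unshelve. all: by end_near. Qed.
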